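(* Let $\Gamma\le n-1$, and let $m\ge 1$ be feasible with respect to $\Gamma$, i.e., there exists a graph on $n$ vertices with $m$ edges and arboricity $\Gamma$. Consider any algorithm for testing triangle-freeness on input graphs with $n$ vertices, $m$ edges and arboricity $\Gamma$. Any such algorithm must perform $\Omega((\Gamma n)/m)$ queries. This holds even if the algorithm is allowed two-sided error.
   Context: General graph model: the algorithm accesses $G=(V,E)$ through three kinds of queries. A degree query on $v$ returns $\deg(v)$. A neighbor query on $(v,i)$ returns the $i$-th neighbor of $v$. A vertex-pair query on $\{u,v\}$ returns whether $\{u,v\}\in E$. A tester for triangle-freeness with proximity parameter $\epsilon$ has two requirements. It accepts with probability at least $2/3$ graphs that are triangle free. It rejects with probability at least $2/3$ graphs that are $\epsilon$-far from being triangle free, meaning more than $\epsilon m$ edges must be removed to make them triangle free. The tester has one-sided error if it always accepts triangle-free graphs; otherwise it has two-sided error. The arboricity of a graph is the minimum number of forests into which its edges can be partitioned.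
   Formalization: It is also assumed that the family (n vertices, m edges, arboricity Γ) contains a triangle-free graph and an ε-far graph; otherwise (e.g. Γ=1) a 0-query algorithm is a tester and the bound fails. The bound is for every ε up to an absolute constant. *)

(* Defs.v *)
From HB Require Import structures.
From mathcomp Require Import all_boot all_order all_algebra.
From mathcomp Require Import all_classical all_reals all_analysis.

Set Implicit Arguments.
Unset Strict Implicit.
Unset Printing Implicit Defensive.

Import Order.TTheory GRing.Theory Num.Theory.

Local Open Scope ring_scope.

(* A graph on the vertex set 'I_n is its set of edges, an edge being a
   two-element set of vertices. *)
Record sgraph (n : nat) := SGraph {
  edges :> {set {set 'I_n}};
  edges_pair : forall e, e \in edges -> #|e| = 2%N
}.

(* The graph notions below are stated for bare edge sets so that they apply
   directly to the sets of edges obtained by removal or by partitioning. *)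
Definition adj (n : nat) (E : {set {set 'I_n}}) : rel 'I_n :=
  fun u v => [set u; v]%SET \in E.

Definition triangle_free (n : nat) (E : {set {set 'I_n}}) : Prop :=
  ~ exists u v w : 'I_n,
      [/\ u != v, v != w & u != w] /\ [/\ adj E u v, adj E v w & adj E u w].

Definition far_from_triangle_free (R : realType) (eps : R) (n : nat)
    (G : sgraph n) : Prop :=
  forall F : {set {set 'I_n}}, F \subset edges G ->
    triangle_free (edges G :\: F)%SET -> eps * #|edges G|%:R < #|F|%:R.

(* [ucycle] admits the degenerate closed walks x, y, x of size 2. *)
Definition forest (n : nat) (E : {set {set 'I_n}}) : Prop :=
  forall c : seq 'I_n, ucycle (adj E) c -> (size c < 3)%N.

Definition forest_partition (n : nat) (E : {set {set 'I_n}})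
    (P : {set {set {set 'I_n}}}) : Prop :=
  finset.partition P E /\ forall F, F \in P -> forest F.

Definition has_arboricity (n : nat) (E : {set {set 'I_n}}) (k : nat) : Prop :=
  (exists2 P, forest_partition E P & #|P| = k) /\
  (forall P, forest_partition E P -> (k <= #|P|)%N).

Definition in_family (n m Gamma : nat) (G : sgraph n) : Prop :=
  #|edges G| = m /\ has_arboricity G Gamma.

Definition feasible (n m Gamma : nat) : Prop :=
  exists G : sgraph n, in_family m Gamma G.

(* What the oracle holds: a graph whose vertices list their neighbors in an
   arbitrary order; the order is part of the input. *)
Record graph_input (n : nat) := GraphInput {
  graph :> sgraph n;
  nbrs : 'I_n -> seq 'I_n;
  nbrs_uniq : forall v, uniq (nbrs v);
  mem_nbrs : forall v u, (u \in nbrs v) = adj graph v u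
}.

Inductive query (n : nat) : Type :=
  | Degree of 'I_n
  | Neighbor of 'I_n & nat
  | VertexPair of 'I_n & 'I_n.

Definition answer (n : nat) (q : query n) : Type :=
  match q with
  | Degree _ => nat
  | Neighbor _ _ => option 'I_n
  | VertexPair _ _ => bool
  end.

(* Neighbors are numbered from 0; [None] answers a number which is at least
   the degree. *)
Definition respond (n : nat) (X : graph_input n) (q : query n) : answer q :=
  match q with
  | Degree v => #|[set u | adj X v u]%SET|
  | Neighbor v i => onth (nbrs X v) i
  | VertexPair u v => adj X u v
  end.

(* Deterministic adaptive algorithms; the output [true] means "accept". *)
Inductive dtree (n : nat) : Type :=
  | Output of bool
  | Ask (q : query n) of (answer q -> dtree n).

Fixpoint output (n : nat) (t : dtree n) (X : graph_input n) : bool :=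
  match t with
  | Output b => b
  | Ask q k => output (k (respond X q)) X
  end.

Fixpoint num_queries (n : nat) (t : dtree n) (X : graph_input n) : nat :=
  match t with
  | Output _ => 0%N
  | Ask q k => (num_queries (k (respond X q)) X).+1
  end.

(* A randomized algorithm is a random deterministic algorithm, over an
   arbitrary probability space of coin tosses. *)
Record rand_alg (R : realType) (n : nat) := RandAlg {
  coins_display : measure_display;
  coins : measurableType coins_display;
  law : probability coins R;
  tree : coins -> dtree n;
  measurable_output : forall (X : graph_input n) (b : bool),
    measurable [set w | output (tree w) X = b]%classic
}.

Definition prob_output (R : realType) (n : nat) (A : rand_alg R n)
    (X : graph_input n) (b : bool) : \bar R :=
  law A [set w | output (tree w) X = b]%classic.

(* Two-sided error; [A] need only be correct on the given family. *)
Definition triangle_freeness_tester (R : realType) (eps : R)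
    (n m Gamma : nat) (A : rand_alg R n) : Prop :=
  forall X : graph_input n, in_family m Gamma X ->
    (triangle_free X -> ((2 / 3)%:E <= prob_output A X true)%E) /\
    (far_from_triangle_free eps X ->
       ((2 / 3)%:E <= prob_output A X false)%E).

(* Worst case over the inputs of the family and over the coin tosses. *)
Definition makes_at_most (R : realType) (n m Gamma : nat) (A : rand_alg R n)
    (q : nat) : Prop :=
  forall X : graph_input n, in_family m Gamma X ->
    forall w : coins A, (num_queries (tree w) X <= q)%N.

(* The family contains graphs of both kinds that a tester has to tell apart.
   By [trivial_tester] below, this is necessary for any lower bound at all.
   It fails, for instance, when Gamma = 1 (forests have no triangle), and when
   m = 2 (Gamma - 1)^2 + 1 with Gamma >= 2: an edge set of that size and of
   arboricity Gamma spans K_(2 Gamma - 1) minus Gamma - 2 edges, which always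
   contains a triangle. *)
Definition nontrivial_family (R : realType) (eps : R) (n m Gamma : nat)
    : Prop :=
  (exists2 G : sgraph n, in_family m Gamma G & triangle_free G) /\
  (exists2 G : sgraph n, in_family m Gamma G & far_from_triangle_free eps G).

Section TrivialTester.
Variables (R : realType) (n : nat).

Lemma measurable_const_output (b : bool) (X : graph_input n) (b' : bool) :
  measurable [set w : unit | output (Output n b) X = b']%classic.
Proof. by []. Qed.

Definition const_alg (b : bool) : rand_alg R n :=
  @RandAlg R n _ unit (dirac tt) (fun=> Output n b)
    (measurable_const_output b).

Lemma trivial_tester (eps : R) (m Gamma : nat) :
  ~ nontrivial_family eps n m Gamma ->
  exists2 A : rand_alg R n, triangle_freeness_tester eps m Gamma A &
                            makes_at_most m Gamma A 0.
Proof.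
have prob1 b X : ((2 / 3)%:E <= prob_output (const_alg b) X b)%E.
  rewrite /prob_output /= (_ : [set _ | _]%classic = setT); last first.
    by apply/seteqP; split.
  rewrite probability_setT lee_fin ler_pdivrMr// mul1r ler_nat//.
move=> triv.
have [yes|no_yes] :=
  pselect (exists2 G : sgraph n, in_family m Gamma G & triangle_free G).
- exists (const_alg true) => // X inX; split=> [_|farX]; first exact: prob1.
  by exfalso; apply: triv; split=> //; exists X.
- exists (const_alg false) => // X inX; split=> [tfX|_]; last exact: prob1.
  by exfalso; apply: no_yes; exists X.
Qed.

End TrivialTester.

(* Main.v *)
Require Import Defs.
From mathcomp Require Import all_boot all_order all_algebra.
From mathcomp Require Import all_classical all_reals all_analysis.
From mathcomp Require Import zify fintype finset.
Import Order.TTheory GRing.Theory Num.Theory.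
Local Open Scope ring_scope.

Set Implicit Arguments.
Unset Strict Implicit.
Unset Printing Implicit Defensive.

(* Write Gamma = k + 1.  Hiding: if a triangle-free and a far graph of the family
   both have at most K non-isolated vertices, then under a random cyclic shift of
   the labels each query meets a non-isolated vertex with probability at most
   K / n, so that q >= n / (3 K).  It remains to find both graphs with
   K = O(m / Gamma).

   An inclusion-minimal graph which is not covered by k forests has arboricity
   Gamma and minimum degree at least Gamma, hence O(m / Gamma) vertices.  Joining
   fresh vertices to at most Gamma old ones preserves the arboricity, which brings
   the number of edges up to m; joining them to a part of one neighbourhood
   creates no triangle, and joining them so as to create copies of K_(a,a,a) with
   a = Theta(Gamma) makes the graph far from triangle-free.  The latter requires
   room for Theta(m) additional edges.  For m >= 3 Gamma^2 one starts from
   K_(2 Gamma - 1).  For smaller m, one starts from the minimal subgraph H of the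
   given triangle-free graph: H has Theta(Gamma) pairwise non-adjacent vertices of
   degree at most 2k (otherwise it would have too many edges), and splitting off
   such a vertex (replacing it by a matching of deg - k non-edges of its
   neighbourhood) saves k edges without making the graph coverable by k forests.
   For small m and Gamma, the given graphs are small enough themselves. *)

(** * Forests, bridges and the edge bound for forests *)

Section Forests.
Local Open Scope nat_scope.
Local Open Scope set_scope.
Variable n : nat.
Implicit Types (E D F : {set {set 'I_n}}) (u v x y : 'I_n).

Lemma adjC E x y : adj E x y = adj E y x.
Proof. by rewrite /adj setUC. Qed.

Lemma adj_sub E D : E \subset D -> subrel (adj E) (adj D).
Proof. by move=> sED x y; apply: (subsetP sED). Qed.

Lemma connect_adjC E : connect_sym (adj E).
Proof. by apply: sym_connect_sym => x y; apply: adjC. Qed.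

Lemma connect_adj_sub E D x y :
  E \subset D -> connect (adj E) x y -> connect (adj D) x y.
Proof.
by move=> sED; apply: connect_sub => a b ab; apply/connect1/(adj_sub sED).
Qed.

Lemma eq_set2 x y u v :
  [set x; y] = [set u; v] -> (x = u /\ y = v) \/ (x = v /\ y = u).
Proof.
move=> eqE.
have /set2P[] : x \in [set u; v] by rewrite -eqE set21.
  move=> xu; subst x; left; split=> //.
  have /set2P[yu|//] : y \in [set u; v] by rewrite -eqE set22.
  have /set2P[|] : v \in [set u; y] by rewrite eqE set22.
    by rewrite yu => ->.
  by move=> ->.
move=> xv; subst x; right; split=> //.
have /set2P[//|yv] : y \in [set u; v] by rewrite -eqE set22.
have /set2P[|] : u \in [set v; y] by rewrite eqE set21.
  by rewrite yv => ->.
by move=> ->.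
Qed.

Lemma adjU1 E x y u v :
  adj ([set u; v] |: E) x y -> [\/ adj E x y, x = u /\ y = v | x = v /\ y = u].
Proof.
rewrite /adj in_setU1 => /orP[/eqP/eq_set2[]|]; first by constructor 2.
  by constructor 3.
by constructor 1.
Qed.

Lemma connect_adjU1 E u v x y : connect (adj ([set u; v] |: E)) x y ->
  [\/ connect (adj E) x y,
      connect (adj E) x u /\ connect (adj E) v y |
      connect (adj E) x v /\ connect (adj E) u y].
Proof.
case/connectP => p + ->; elim: p x => [|z p IH] x /=.
  by constructor 1; apply: connect0.
case/andP=> /adjU1 xz /IH{}IH; case: xz => [xz|[-> ->]|[-> ->]] in IH *.
- have c := connect1 xz.
  case: IH => [h|[h h']|[h h']].
  + by constructor 1; apply: connect_trans c h.
  + by constructor 2; split=> //; apply: connect_trans c h.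
  + by constructor 3; split=> //; apply: connect_trans c h.
- case: IH => [h|[h h']|[h h']].
  + by constructor 2.
  + by constructor 2.
  + by constructor 1.
- case: IH => [h|[h h']|[h h']].
  + by constructor 3.
  + by constructor 1.
  + by constructor 3.
Qed.

(** A path avoiding the edge [xy], once shortened, closes up with that edge to a cycle of length at
    least 3; conversely, a cycle without its first edge is such a path. So forests are the graphs
    all of whose edges are bridges, a form suited to adding and removing edges. *)
Lemma forestP E :
  forest E <->
  forall x y, x != y -> adj E x y -> ~~ connect (adj (E :\ [set x; y])) x y.
Proof.
split=> [fE x y xy Exy|bE c].
  apply/negP => /connectP[p0 xp0 yE].
  case/shortenP: xp0 yE => p xp up _ yE.
  case: p => [|z [|z' p]] in xp up yE *.
  - by move: xy; rewrite yE /= eqxx.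
  - by move: xp; rewrite /= in yE *; rewrite -yE /adj in_setD1 eqxx.
  - have /fE // : ucycle (adj E) [:: x, z, z' & p].
    apply/andP; split=> //.
    rewrite /cycle rcons_path yE in Exy *.
    apply/andP; split; last by rewrite adjC.
    by apply: sub_path xp; apply: adj_sub; apply: subsetDl.
case: c => [|x [|y [|z p]]] // /andP[cE uE]; exfalso.
have xy : x != y by move: uE => /= /andP[]; rewrite inE negb_or => /andP[].
move: cE => /=  /andP[Exy pE].
have /negP[] := bE x y xy Exy; rewrite connect_adjC.
apply/connectP; exists (rcons (z :: p) x); last by rewrite last_rcons.
have xN : x \notin [:: y, z & p] by move: uE => /andP[].
have yN : y \notin z :: p by move: uE => /andP[_ /andP[]].
rewrite rcons_path; move: pE; rewrite -[_ && _]/(path (adj E) y (rcons (z :: p) x)).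
rewrite rcons_path => /andP[pE lE]; apply/andP; split.
  apply: (@sub_in_path _ [in [:: y, z & p]] (adj E)) pE; last first.
    by apply/allP.
  move=> a b; rewrite !inE => aP bP; rewrite /adj in_setD1 => ->; rewrite andbT.
  apply/eqP => /eq_set2[[ax _]|[_ bx]].
    by move: xN; rewrite -ax inE aP.
  by move: xN; rewrite -bx inE bP.
move: lE; rewrite /adj in_setD1 => ->; rewrite andbT.
have lz : last y (z :: p) \in z :: p by rewrite /= mem_last.
apply/eqP => /eq_set2[[lx _]|[ly _]].
  by move: xN; rewrite inE -lx lz orbT.
by move: yN; rewrite -ly lz.
Qed.

Lemma forest_sub E D : E \subset D -> forest D -> forest E.
Proof.
move=> sED fD c /andP[cE uE]; apply: fD; apply/andP; split=> //.
case: c cE {uE} => //= x p; apply: sub_path; exact: adj_sub.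
Qed.

Lemma forest0 : forest (set0 : {set {set 'I_n}}).
Proof. by apply/forestP => x y _; rewrite /adj inE. Qed.

Lemma forestU1 E u v :
  forest E -> ~~ connect (adj E) u v -> forest ([set u; v] |: E).
Proof.
move=> /forestP fE nuv; apply/forestP => x y xy.
case: (eqVneq [set x; y] [set u; v]) => [e|ne] Exy.
  rewrite e setU1K; last by apply: contra nuv => uvE; apply: connect1.
  apply: contra nuv.
  by case: (eq_set2 e) => -[<- <-] //; rewrite connect_adjC.
have {}Exy : adj E x y.
  by move: Exy; rewrite /adj in_setU1 (negPf ne).
have -> : ([set u; v] |: E) :\ [set x; y] = [set u; v] |: (E :\ [set x; y]).
  apply/setP => e; rewrite !inE; case: (eqVneq e [set u; v]) => [->|] //=.
  by rewrite eq_sym ne.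
have nxy := fE _ _ xy Exy.
have Exy' := connect1 Exy.
have sub a b : connect (adj (E :\ [set x; y])) a b -> connect (adj E) a b.
  by apply: connect_adj_sub; apply: subsetDl.
(* A bypass of the old edge [xy] through [uv] would, together with [xy], connect [u] to [v] in
   [E]. *)
apply/negP => /connect_adjU1[c|[/sub c /sub c']|[/sub c /sub c']].
- by rewrite c in nxy.
- case/negP: nuv; rewrite connect_adjC.
  by rewrite connect_adjC in Exy'; apply: connect_trans c' (connect_trans Exy' c).
- by case/negP: nuv; apply: connect_trans c' (connect_trans _ c); rewrite connect_adjC.
Qed.

Lemma connect_isolated E v x :
  v \notin cover E -> connect (adj E) v x -> x = v.
Proof.
move=> vE /connectP[[|z p] //= /andP[vz _] _].
case/negP: vE; apply/bigcupP; exists [set v; z] => //; exact: set21.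
Qed.

(* Contracting the classes of [E] to those of [E + uv] is surjective but not injective. *)
Lemma forest_card E (S : {set 'I_n}) : forest E -> cover E \subset S ->
  (forall e, e \in E -> #|e| = 2) -> S != set0 -> #|E| < #|S|.
Proof.
move=> fE sE E2 S0.
pose cl D x := [set y | connect (adj D) x y].
have clE D x y : connect (adj D) x y -> cl D x = cl D y.
  move=> c; apply/setP => z; rewrite !inE; apply/idP/idP; last exact: connect_trans.
  by apply: connect_trans; rewrite connect_adjC.
pose comps D := [set cl D x | x in S].
(* The induction runs on the stronger inequality that also counts components; there is at least one,
   as [S] is nonempty. *)
suff : #|E| + #|comps E| <= #|S|.
  apply: leq_trans; rewrite -[ltnLHS]addn0 ltn_add2l card_gt0.
  have [x xS] := set0Pn _ S0.
  by apply/set0Pn; exists (cl E x); apply: imset_f.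
have [N] : exists N, #|E| = N by exists #|E|.
elim: N E fE sE E2 => [|N IH] E fE sE E2 EN.
  by rewrite EN add0n leq_imset_card.
have /card_gt0P[e eE] : 0 < #|E| by rewrite EN.
have /cards2P[x [y [xy exy]]] : #|e| == 2 by apply/eqP/E2.
pose D := E :\ e.
have ED : E = [set x; y] |: D by rewrite -exy setD1K.
have sDE : D \subset E by apply: subsetDl.
have cD : #|D| = N by move: EN; rewrite (cardsD1 e E) eE => -[].
have nD : ~~ connect (adj D) x y.
  by have /forestP := fE; move=> /(_ x y xy); rewrite /D exy; apply; rewrite /adj -exy.
have {}IH : N + #|comps D| <= #|S|.
  rewrite -{1}cD; apply: IH => //; first exact: forest_sub fE.
    apply: subset_trans sE; apply/subsetP => z /bigcupP[f fD zf].
    by apply/bigcupP; exists f => //; apply: (subsetP sDE).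
  by move=> f /(subsetP sDE)/E2.
have xS : x \in S.
  by apply: (subsetP sE); apply/bigcupP; exists e => //; rewrite exy set21.
have yS : y \in S.
  by apply: (subsetP sE); apply/bigcupP; exists e => //; rewrite exy set22.
pose g (T : {set 'I_n}) := \bigcup_(z in T) cl E z.
have gE z : g (cl D z) = cl E z.
  apply/setP => w; apply/bigcupP/idP => [[a]|wz]; last first.
    by exists z => //; rewrite inE.
  rewrite inE => /(connect_adj_sub sDE)/clE zE.
  by rewrite -zE.
have compsE : comps E = g @: comps D.
  rewrite /comps -imset_comp; apply: eq_imset => z; by rewrite /= gE.
have : #|comps E| < #|comps D|.
  rewrite compsE ltn_neqAle leq_imset_card andbT; apply/negP => /imset_injP inj.
  have : cl D x = cl D y.
    apply: inj; rewrite ?imset_f // !gE; apply: clE; apply: connect1.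
    by rewrite /adj -exy.
  move/setP/(_ y); rewrite !inE connect0 => c; by rewrite c in nD.
by rewrite EN; lia.
Qed.

End Forests.

(** * Covers by k forests, and splitting off a vertex *)

Section Arboricity.
Local Open Scope nat_scope.
Local Open Scope set_scope.
Variable n : nat.
Implicit Types (E D : {set {set 'I_n}}) (u v x y : 'I_n).

(** The classes may overlap and may contain edges outside [E]. As subsets of forests are forests,
    this does not affect the existence of k forests, and it makes passing to subgraphs immediate. *)
Definition forest_cover k E (F : 'I_k -> {set {set 'I_n}}) : Prop :=
  (forall i, forest (F i)) /\ forall e, e \in E -> exists i, e \in F i.

Definition arboric k E : Prop := exists F, @forest_cover k E F.

(** Repetitions are kept, so [uniq (endpoints M)] says that [M] is a matching without loops. *)
Definition endpoints (M : seq ('I_n * 'I_n)) : seq 'I_n :=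
  flatten [seq [:: p.1; p.2] | p <- M].

Definition free_at k (F : 'I_k -> {set {set 'I_n}}) v : {set 'I_k} :=
  [set i | v \notin cover (F i)].

Definition recolor k (F : 'I_k -> {set {set 'I_n}}) i A : 'I_k -> {set {set 'I_n}} :=
  fun j => if j == i then A else F j.

Lemma mem_cover E e x : e \in E -> x \in e -> x \in cover E.
Proof. by move=> eE xe; apply/bigcupP; exists e. Qed.

Lemma coverS E D : E \subset D -> cover E \subset cover D.
Proof.
by move=> s; apply/subsetP => x /bigcupP[e /(subsetP s) eD xe]; apply: mem_cover xe.
Qed.

Lemma free_at_recolor k (F : 'I_k -> {set {set 'I_n}}) v i A :
  free_at F v :\ i \subset free_at (recolor F i A) v.
Proof.
by apply/subsetP => j; rewrite !inE /recolor => /andP[/negPf->].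
Qed.

Lemma forest_recolor k (F : 'I_k -> {set {set 'I_n}}) i A :
  (forall j, forest (F j)) -> forest A -> forall j, forest (recolor F i A j).
Proof. by move=> fF fA j; rewrite /recolor; case: eqP. Qed.

(** Each spoke at [v] receives a separate colour in which [v] is isolated; there it is a pendant
    edge and closes no cycle. *)
Lemma forest_cover_spokes k E v (R : {set 'I_n}) (F : 'I_k -> {set {set 'I_n}}) :
  forest_cover E F -> v \notin R -> #|R| <= #|free_at F v| ->
  arboric k (E :|: [set [set v; x] | x in R]).
Proof.
move: {-1}#|R| (erefl #|R|) => N; elim: N R E F => [|N IH] R E F RN [fF cF] vR le.
  by exists F; split=> // e; rewrite (cards0_eq RN) imset0 setU0; apply: cF.
have /card_gt0P[x xR] : 0 < #|R| by rewrite RN.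
have /card_gt0P[i] : 0 < #|free_at F v| by apply: leq_trans le.
move=> iF; have vFi : v \notin cover (F i) by rewrite inE in iF.
have vx : v != x by apply: contraNneq vR => ->.
have -> : E :|: [set [set v; z] | z in R] =
    ([set v; x] |: E) :|: [set [set v; z] | z in R :\ x].
  by rewrite -{1}(setD1K xR) imsetU1 setUCA setUA.
apply: (IH _ _ (recolor F i ([set v; x] |: F i))).
- by move: RN; rewrite (cardsD1 x) xR => -[].
- split.
    apply: forest_recolor => //; apply: forestU1 => //.
    by apply/negP => /(connect_isolated vFi) xv; rewrite xv eqxx in vx.
  move=> e; rewrite in_setU1 => /orP[/eqP->|/cF[j ej]].
    by exists i; rewrite /recolor eqxx setU11.
  by exists j; rewrite /recolor; case: eqP => [<-|//]; rewrite setU1r.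
- by rewrite !inE negb_and vR orbT.
- apply: leq_trans (subset_leq_card (free_at_recolor _ _ _ _)).
  by move: le; rewrite (cardsD1 i) iF.
Qed.

(* Processing the added edge [xy] of colour [i]: if [v] is isolated in that
   colour, the edge is subdivided by [v]; otherwise one of [vx], [vy] can replace
   it, and the other one joins the pendant edges kept for the colours which are
   still free at [v]. *)
Lemma forest_cover_split k E v M (R : {set 'I_n}) (F : 'I_k -> {set {set 'I_n}}) :
  forest_cover E F ->
  (forall p, p \in M -> exists i, [set p.1; p.2] \in F i) ->
  (forall p, p \in M -> [set p.1; p.2] \notin E) ->
  uniq (endpoints M) -> v \notin endpoints M -> v \notin R ->
  #|R| + size M <= #|free_at F v| ->
  arboric k (E :|: [set [set v; x] | x in R :|: [set x in endpoints M]]).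
Proof.
elim: M R E F => [|[x y] M IH] R E F cE cM nM uM vM vR le.
  rewrite (_ : _ :|: [set x in endpoints [::]] = R).
    by apply: forest_cover_spokes cE vR _; rewrite addn0 in le.
  by apply/setP => x; rewrite !inE orbF.
have [fF cF] := cE.
move: uM vM; rewrite -[endpoints _]/(x :: y :: endpoints M) => uM vM.
have [xy xM yM uM'] : [/\ x != y, x \notin endpoints M, y \notin endpoints M
    & uniq (endpoints M)].
  by move: uM; rewrite /= inE negb_or => /andP[/andP[-> ->] /andP[-> ->]].
have [vx vy vM'] : [/\ v != x, v != y & v \notin endpoints M].
  by move: vM; rewrite !inE !negb_or => /and3P[].
have endM p : p \in M -> (p.1 \in endpoints M) * (p.2 \in endpoints M).
  move=> pM; split; apply/flattenP; exists [:: p.1; p.2];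
    rewrite ?map_f ?inE ?eqxx ?orbT //; exact: map_f (fun p => [:: p.1; p.2]) _ _ pM.
have nxy : [set x; y] \notin E by apply: (nM (x, y)); rewrite mem_head.
have [i xyi] := cM (x, y) (mem_head _ _).
rewrite /= in xyi.
pose F1 := F i :\ [set x; y].
have fF1 : forest F1 by apply: forest_sub (fF i); apply: subsetDl.
have bxy : ~~ connect (adj F1) x y by have /forestP := fF i; apply.
(* [W] is the set of ends of the spokes replacing [xy] in colour [i]. *)
have step (W R' : {set 'I_n}) :
    forest ([set [set v; z] | z in W] :|: F1) ->
    v \notin R' -> W :|: R' = R :|: [set x; y] ->
    #|R'| + size M <= #|free_at (recolor F i ([set [set v; z] | z in W] :|: F1)) v| ->
    arboric k (E :|: [set [set v; z] | z in R :|: [set z in x :: y :: endpoints M]]).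
  move=> fW vR' eR le'.
  have -> : E :|: [set [set v; z] | z in R :|: [set z in x :: y :: endpoints M]] =
      (E :|: [set [set v; z] | z in W]) :|:
      [set [set v; z] | z in R' :|: [set z in endpoints M]].
    rewrite -setUA; congr (_ :|: _); rewrite -imsetU; congr imset.
    have -> : [set z in x :: y :: endpoints M] = [set x; y] :|: [set z in endpoints M].
      by apply/setP => z; rewrite !inE orbA.
    by rewrite (setUA R) (setUA W) eR.
  apply: (IH _ _ (recolor F i ([set [set v; z] | z in W] :|: F1))) => //.
  - split; first exact: forest_recolor.
    move=> e /setUP[eE|eW]; last by exists i; rewrite /recolor eqxx inE eW.
    have [j ej] := cF e eE; exists j; rewrite /recolor; case: eqP => // ji.
    rewrite ji in ej; rewrite in_setU in_setD1 ej andbT.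
    by apply/orP; right; apply: contraNneq nxy => <-.
  - move=> p pM; have [j ej] := cM p (mem_behead (s := (x, y) :: M) pM).
    exists j; rewrite /recolor; case: eqP => // ji.
    rewrite ji in ej; rewrite in_setU in_setD1 ej andbT; apply/orP; right; apply/eqP => /eq_set2.
    by have [p1 p2] := endM p pM; case=> -[px _]; move: p1; rewrite px ?(negPf xM) ?(negPf yM).
  - move=> p pM; rewrite inE negb_or nM ?inE ?pM ?orbT //=.
    apply/imsetP => -[z _ pz]; have [p1 p2] := endM p pM.
    by case/eq_set2: pz => -[p1v p2v]; [rewrite -p1v p1 in vM'|rewrite -p2v p2 in vM'].
have leR z : #|z |: R| + size M <= #|R| + (size M).+1.
  by rewrite cardsU1 addnS -addSn leq_add2r -add1n leq_add2r leq_b1.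
have [vi|vi] := boolP (i \in free_at F v).
  apply: (step [set x; y] R) => //; last first.
  - apply: leq_trans (subset_leq_card (free_at_recolor _ _ _ _)).
    by move: le; rewrite (cardsD1 i) vi /= addnS.
  - by rewrite setUC.
  rewrite imsetU !imset_set1 -setUA.
  have vF1 : v \notin cover F1.
    rewrite inE in vi; apply: contra vi; apply: subsetP; apply: coverS; exact: subsetDl.
  have fy : forest ([set v; y] |: F1).
    by apply: forestU1 => //; apply/negP => /(connect_isolated vF1)/eqP;
      rewrite eq_sym (negPf vy).
  apply: forestU1 => //; apply/negP => /connect_adjU1[|[_]|[+ _]].
  - by move/(connect_isolated vF1)/eqP; rewrite eq_sym (negPf vx).
  - by rewrite connect_adjC (negPf bxy).
  - by move/(connect_isolated vF1)/eqP; rewrite eq_sym (negPf vy).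
have sfree A : free_at F v \subset free_at (recolor F i A) v.
  apply: subset_trans (free_at_recolor F v i A); apply/subsetP => j jF.
  by rewrite in_setD1 jF andbT; apply: contraNneq vi => <-.
have stepz z z' : [set z; z'] = [set x; y] -> v != z' ->
    ~~ connect (adj F1) v z ->
    arboric k (E :|: [set [set v; z] | z in R :|: [set z in x :: y :: endpoints M]]).
  move=> ez vz' nz; apply: (step [set z] (z' |: R)).
  - by rewrite imset_set1; apply: forestU1.
  - by rewrite in_setU1 negb_or vz'.
  - by rewrite setUA ez setUC.
  - by apply: leq_trans (leR _) _; apply: leq_trans le _; apply: subset_leq_card.
(* If [v] were connected to both ends, then [x] and [y] would be connected without the edge [xy] of
   a forest; so one of the two spokes closes no cycle. *)
have [vx1|/(stepz x y)] := boolP (connect (adj F1) v x); last exact.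
apply: (stepz y x) => //; first by rewrite setUC.
apply: contra bxy => vy1; apply: connect_trans vy1; by rewrite connect_adjC.
Qed.

Definition nbrs_in E v : {set 'I_n} := [set u | adj E v u].

Definition del_vertex E v : {set {set 'I_n}} := [set e in E | v \notin e].

Definition simple E : Prop := forall e, e \in E -> #|e| = 2.

Lemma simple_sub E D : E \subset D -> simple D -> simple E.
Proof. by move=> s sD e /(subsetP s)/sD. Qed.

Lemma simple_edge E e v : simple E -> e \in E -> v \in e ->
  exists2 x, x != v & e = [set v; x].
Proof.
move=> sE eE ve; have /eqP/cards2P[x [y [xy ee]]] := sE _ eE.
by move: ve; rewrite ee => /set2P[->|->]; [exists y; rewrite // eq_sym|exists x; rewrite // setUC].
Qed.

Lemma del_vertexE E v : simple E ->
  E = del_vertex E v :|: [set [set v; x] | x in nbrs_in E v].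
Proof.
move=> sE; apply/setP => e; rewrite !inE; apply/idP/idP => [eE|].
  rewrite eE /=; case: (boolP (v \in e)) => //= ve.
  have [x xv ee] := simple_edge sE eE ve; apply/imsetP; exists x => //.
  by rewrite inE /adj -ee.
by case/orP => [/andP[]|/imsetP[x]] //; rewrite inE => + ->.
Qed.

Lemma simple_nbrs_irr E v : simple E -> v \notin nbrs_in E v.
Proof. by move=> sE; rewrite inE; apply/negP => /sE; rewrite setUid cards1. Qed.

Lemma spoke_inj v : injective (fun x : 'I_n => [set v; x]).
Proof. by move=> x y /eq_set2[[]|[-> ->]]. Qed.

Lemma card_del_vertex E v : simple E ->
  #|del_vertex E v| + #|nbrs_in E v| = #|E|.
Proof.
move=> sE; rewrite [in RHS](del_vertexE v sE) cardsU card_imset; last exact: spoke_inj.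
rewrite [_ :&: _](_ : _ = set0) ?cards0 ?subn0 //.
apply/setP => e; rewrite !inE; apply/negP => /andP[/andP[_ ve] /imsetP[x _ ee]].
by rewrite ee set21 in ve.
Qed.

Lemma del_vertex_sub E v : del_vertex E v \subset E.
Proof. by apply/subsetP => e; rewrite inE => /andP[]. Qed.

Lemma arboric_sub k E D : E \subset D -> arboric k D -> arboric k E.
Proof. by move=> s [F [fF cF]]; exists F; split=> // e /(subsetP s)/cF. Qed.

(** This inverts splitting off. Once [v] is deleted, all k colours are free at [v]. Each pair of [M]
    uses up at most one of them for its two spokes, and every other neighbour uses one, so that deg
    v - size M colours suffice. *)
Lemma arboric_split k E v M : simple E ->
  uniq (endpoints M) -> {subset endpoints M <= nbrs_in E v} ->
  (forall p, p \in M -> ~~ adj E p.1 p.2) ->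
  #|nbrs_in E v| <= k + size M ->
  arboric k (del_vertex E v :|: [set [set p.1; p.2] | p in M]) -> arboric k E.
Proof.
move=> sE uM sM nM le [F [fF cF]].
pose F' i := del_vertex (F i) v.
have vN := simple_nbrs_irr v sE.
have vM : v \notin endpoints M by apply: contra vN; apply: sM.
have sz : size (endpoints M) = (size M).*2.
  by rewrite /endpoints; elim: (M) => //= p M' /= ->.
pose R := nbrs_in E v :\: [set x in endpoints M].
have RE : R :|: [set x in endpoints M] = nbrs_in E v.
  apply/setP => x; rewrite in_setU in_setD !in_set.
  case: (boolP (x \in endpoints M)) => [xM|_]; last by rewrite orbF.
  by rewrite orbT; have := sM _ xM; rewrite inE => ->.
have cardR : #|R| + (size M).*2 = #|nbrs_in E v|.
  rewrite -sz -[in RHS]RE -(card_uniqP uM) cardsU.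
  rewrite [_ :&: _](_ : _ = set0); last by rewrite /R setDE -setIA (setIC (~: _)) setICr setI0.
  by rewrite cards0 subn0 (cardsE (mem (endpoints M))).
rewrite (del_vertexE v sE) -RE.
apply: (@forest_cover_split k _ v M R F') => //.
- split=> [i|e]; first by apply: forest_sub (fF i); apply: del_vertex_sub.
  move=> eE; have [i ei] : exists i, e \in F i by apply: cF; rewrite inE eE.
  by exists i; rewrite inE ei; move: eE; rewrite inE => /andP[].
- move=> p pM; have [i ei] : exists i, [set p.1; p.2] \in F i.
    by apply: cF; rewrite inE (imset_f (fun p => [set p.1; p.2])) ?orbT.
  exists i; rewrite inE ei /=; apply: contra vM => /set2P ve.
  apply/flattenP; exists [:: p.1; p.2].
    exact: map_f (fun p => [:: p.1; p.2]) _ _ pM.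
  by rewrite !inE; case: ve => ->; rewrite eqxx ?orbT.
- by move=> p pM; rewrite inE negb_and; have := nM p pM; rewrite /adj => ->.
- by rewrite inE negb_and vN orbT.
- have -> : free_at F' v = setT.
    apply/setP => i; rewrite !inE; apply/negP => /bigcupP[e].
    by rewrite inE => /andP[_ /negP].
  by rewrite cardsT card_ord; move: le; rewrite -cardR -addnn addnA leq_add2r.
Qed.

Lemma arboric_peel k E v : simple E -> #|nbrs_in E v| <= k ->
  arboric k (del_vertex E v) -> arboric k E.
Proof.
move=> sE le aE; apply: (@arboric_split k E v [::]) => //; first by rewrite addn0.
apply: arboric_sub aE; apply/subsetP => e; rewrite inE => /orP[//|/imsetP[]//].
Qed.

Lemma arboric0 k : arboric k (set0 : {set {set 'I_n}}).
Proof.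
by exists (fun=> set0); split=> [i|e]; [apply: forest0|rewrite inE].
Qed.

Lemma arboricU1 k E x y : x != y -> arboric k E -> arboric k.+1 ([set x; y] |: E).
Proof.
move=> xy [F [fF cF]].
exists (fun i => if unlift ord0 i is Some j then F j else [set [set x; y]]); split.
  move=> i; case: unliftP => [j _|_]; first exact: fF.
  rewrite -[[set _]]setU0; apply: forestU1; first exact: forest0.
  apply/negP => /connect_isolated yx; rewrite yx ?eqxx // in xy.
  by apply/negP => /bigcupP[e]; rewrite inE.
move=> e; rewrite in_setU1 => /orP[/eqP->|/cF[i ei]].
  by exists ord0; rewrite unlift_none set11.
by exists (lift ord0 i); rewrite liftK.
Qed.

(** An inclusion-minimal subgraph without a cover by k forests works: dropping one edge makes it
    coverable, and that edge gets a forest of its own; a vertex of degree at most k could be peeled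
    off. *)
Lemma arboric_critical k E : simple E -> ~ arboric k E ->
  exists E', [/\ E' \subset E, ~ arboric k E', arboric k.+1 E' &
                forall v, v \in cover E' -> k < #|nbrs_in E' v|].
Proof.
move=> sE nE.
have [D] := @minset_exists _ (fun D => `[< ~ arboric k D >]) E (asboolT nE).
case/minsetP => /asboolP nD minD sD.
have aD D' : D' \proper D -> arboric k D'.
  move=> pD; apply: contrapT => nD'.
  move: (pD); rewrite (minD D') ?properxx ?(proper_sub pD) //; exact/asboolP.
have smD := simple_sub sD sE.
exists D; split=> //.
  have [D0|[e eD]] := set_0Vmem D; first by rewrite D0 in nD; case: nD; apply: arboric0.
  have /eqP/cards2P[x [y [xy ee]]] := smD _ eD.
  rewrite -(setD1K eD) ee; apply: arboricU1 => //; apply: aD; rewrite -ee.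
  exact: properD1.
move=> v /bigcupP[e eD ve]; rewrite ltnNge; apply/negP => le; apply: nD.
apply: arboric_peel le _ => //; apply: aD; apply/properP; split.
  exact: del_vertex_sub.
by exists e => //; rewrite inE eD ve.
Qed.

Lemma has_arboricity_arboric E k :
  has_arboricity E k.+1 <-> arboric k.+1 E /\ ~ arboric k E.
Proof.
(* A cover becomes a partition by assigning each edge to one forest containing it; empty blocks
   vanish, whence the inequality. Conversely, the list of blocks is padded with empty forests. *)
have part j : (exists2 P, forest_partition E P & #|P| <= j) <-> arboric j E.
  split=> [[P [pP fP] le]|[F [fF cF]]].
    pose F (i : 'I_j) := nth set0 (enum P) i; exists F; split=> [i|e eE].
      have [lt|ge] := ltnP i (size (enum P)).
        by apply: fP; rewrite -mem_enum mem_nth.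
      by rewrite /F nth_default //; apply: forest0.
    move: eE; rewrite -(cover_partition pP) => /bigcupP[A AP eA].
    have lt : index A (enum P) < j.
      by apply: leq_trans le; rewrite cardE index_mem mem_enum.
    by exists (Ordinal lt); rewrite /F /= nth_index ?mem_enum.
  pose f e := [pick i | e \in F i].
  have fE e : e \in E -> exists2 i, f e = Some i & e \in F i.
    move=> /cF[i ei]; rewrite /f; case: pickP => [i' ei'|/(_ i)]; first by exists i'.
    by rewrite ei.
  exists (preim_partition f E).
    split; first exact: preim_partitionP.
    move=> A /imsetP[e eE ->]; have [i fe _] := fE e eE.
    apply: forest_sub (fF i); apply/subsetP => e'; rewrite inE => /andP[e'E].
    by have [i' -> ei'] := fE e' e'E; rewrite fe => /eqP[->].
  have sub : preim_partition f E \subset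
      [set [set e in E | f e == Some i] | i : 'I_j].
    apply/subsetP => A /imsetP[e eE ->]; have [i fe _] := fE e eE.
    by apply/imsetP; exists i => //; apply/setP => e'; rewrite !inE fe eq_sym.
  apply: leq_trans (subset_leq_card sub) _; apply: leq_trans (leq_imset_card _ _) _.
  by rewrite card_ord.
split=> [[[P fP Pk] mP]|[aE nE]].
  split; first by apply/part; exists P; rewrite ?Pk.
  by move/part => [Q /mP le] /(leq_trans le); rewrite ltnn.
have ge P : forest_partition E P -> k < #|P|.
  by move=> fP; rewrite ltnNge; apply/negP => le; apply/nE/part; exists P.
split; last exact: ge.
have /part[P fP le] := aE; exists P => //; apply/eqP.
by rewrite eqn_leq le ge.
Qed.

End Arboricity.

(** * Adding fresh vertices and triangles at bounded arboricity *)

Section Extensions.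
Local Open Scope nat_scope.
Local Open Scope set_scope.
Variable n : nat.
Implicit Types (E D : {set {set 'I_n}}) (u v x y : 'I_n) (A B C N S T U : {set 'I_n}).

Lemma subset_of_card A s : s <= #|A| -> exists2 B : {set 'I_n}, B \subset A & #|B| = s.
Proof.
move=> le; exists [set x in take s (enum A)].
  by apply/subsetP => x; rewrite inE => /mem_take; rewrite mem_enum.
rewrite (cardsE (mem (take s (enum A)))).
have /card_uniqP -> : uniq (take s (enum A)) by rewrite take_uniq // enum_uniq.
by rewrite size_takel // -cardE.
Qed.

Lemma fresh_vertices U t : #|U| + t <= n ->
  exists2 T : {set 'I_n}, [disjoint T & U] & #|T| = t.
Proof.
move=> le; have [|T sT cT] := @subset_of_card (~: U) t.
  by have := cardsC U; rewrite card_ord; lia.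
by exists T => //; rewrite disjoints_subset.
Qed.

Lemma cardUd (T : finType) (A B : {set T}) : [disjoint A & B] -> #|A :|: B| = #|A| + #|B|.
Proof. by rewrite cardsU -setI_eq0 => /eqP->; rewrite cards0 subn0. Qed.

Lemma handshake E : simple E -> \sum_v #|nbrs_in E v| = #|E|.*2.
Proof.
move=> sE.
transitivity (\sum_v \sum_(e in E) (v \in e)).
  apply: eq_bigr => v _.
  rewrite -(card_imset (nbrs_in E v) (@spoke_inj n v)) -sum1_card big_mkcond [RHS]big_mkcond /=.
  apply: eq_bigr => e _.
  case: imsetP => [[x]|nx].
    by rewrite inE => xE ->; rewrite /adj in xE; rewrite xE set21.
  case: ifP => // eE; case: (boolP (v \in e)) => // ve.
  have [x _ ee] := simple_edge sE eE ve.
  by case: nx; exists x => //; rewrite inE /adj -ee.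
rewrite exchange_big /= -[RHS]muln2 -sum_nat_const; apply: eq_bigr => e eE.
by rewrite -(sE e eE) -sum1_card [RHS]big_mkcond.
Qed.

Lemma min_degree_cover E d : simple E ->
  (forall v, v \in cover E -> d <= #|nbrs_in E v|) -> #|cover E| * d <= #|E|.*2.
Proof.
move=> sE dE; rewrite -handshake // -sum_nat_const.
rewrite [leqRHS](bigID (mem (cover E))) /=; apply: leq_trans (leq_addr _ _).
exact: leq_sum.
Qed.

Lemma card_cover_simple E : simple E -> #|cover E| <= #|E|.*2.
Proof.
move=> sE; rewrite -[leqLHS]muln1; apply: min_degree_cover => // v /bigcupP[e eE ve].
have [x _ ee] := simple_edge sE eE ve.
by apply/card_gt0P; exists x; rewrite inE /adj -ee.
Qed.

Definition join T N : {set {set 'I_n}} := [set [set p.1; p.2] | p in setX T N].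

Lemma joinP T N e :
  reflect (exists t x, [/\ t \in T, x \in N & e = [set t; x]]) (e \in join T N).
Proof.
apply: (iffP imsetP) => [[[t x]]|[t [x [tT xN ->]]]].
  by rewrite inE => /andP[tT xN] ->; exists t, x.
by exists (t, x) => //; rewrite inE tT.
Qed.

Lemma adj_join T N x y : adj (join T N) x y ->
  (x \in T /\ y \in N) \/ (x \in N /\ y \in T).
Proof. by move/joinP => [t [z [tT zN /eq_set2[[-> ->]|[-> ->]]]]]; [left|right]. Qed.

Lemma card_join T N : [disjoint T & N] -> #|join T N| = #|T| * #|N|.
Proof.
move=> dTN; rewrite card_in_imset ?cardsX // => -[t x] [t' x'].
rewrite !inE /= => /andP[tT xN] /andP[tT' xN'] /eq_set2[[-> ->]//|[tx _]].
by have := disjointFr dTN tT; rewrite tx xN'.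
Qed.

Lemma simple_join T N : [disjoint T & N] -> simple (join T N).
Proof.
move=> dTN e /joinP[t [x [tT xN ->]]]; rewrite cards2; case: eqP => // tx.
by have := disjointFr dTN tT; rewrite tx xN.
Qed.

Lemma cover_join T N : cover (join T N) \subset T :|: N.
Proof.
apply/subsetP => z /bigcupP[e /joinP[t [x [tT xN ->]]]].
by case/set2P=> ->; rewrite inE ?tT ?xN ?orbT.
Qed.

Lemma simpleU E D : simple E -> simple D -> simple (E :|: D).
Proof. by move=> sE sD e /setUP[/sE|/sD]. Qed.

Lemma coverU E D : cover (E :|: D) = cover E :|: cover D.
Proof. by rewrite /cover bigcup_setU. Qed.

Lemma disjoint_join E T N : [disjoint T & cover E] -> [disjoint E & join T N].
Proof.
move=> dT; rewrite -setI_eq0; apply/eqP/setP => e; rewrite !inE.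
apply/negP => /andP[eE /joinP[t [x [tT xN ee]]]].
have := disjointFr dT tT; rewrite (mem_cover eE) // ee; exact: set21.
Qed.

(** The new vertices are peeled off one by one: each has all its neighbours in [N], hence degree at
    most k. *)
Lemma arboric_join k E T N : simple E -> [disjoint T & cover E] ->
  [disjoint T & N] -> #|N| <= k -> arboric k E -> arboric k (E :|: join T N).
Proof.
move=> sE + + le aE; have [s] : exists s, #|T| = s by exists #|T|.
elim: s T => [|s IH] T cT dE dN.
  apply: arboric_sub aE; rewrite (cards0_eq cT).
  apply/subsetP => e /setUP[//|/joinP[t [x []]]]; by rewrite inE.
have /card_gt0P[v vT] : 0 < #|T| by rewrite cT.
have sT : T :\ v \subset T := subsetDl _ _.
apply: (@arboric_peel _ _ _ v).
- by apply: simpleU => //; apply: simple_join.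
- apply: leq_trans le; apply/subset_leq_card/subsetP => x; rewrite inE /adj in_setU.
  case/orP=> [vxE|/adj_join[[_ //]|[vN _]]].
    have := disjointFr dE vT; rewrite (mem_cover vxE) //; exact: set21.
  by have := disjointFr dN vT; rewrite vN.
- apply: arboric_sub (IH (T :\ v) _ _ _).
  + apply/subsetP => e; rewrite !inE => /andP[/orP[->//|/joinP[t [x [tT xN ->]]] ve]].
    apply/orP; right; apply/joinP; exists t, x; split=> //; rewrite !inE tT andbT.
    by apply: contraNneq ve => ->; rewrite set21.
  + by move: cT; rewrite (cardsD1 v) vT => -[].
  + exact: disjointWl dE.
  + exact: disjointWl dN.
Qed.

Definition independent E N : Prop := forall x y, x \in N -> y \in N -> ~~ adj E x y.

Lemma triangle_free_sub E D : E \subset D -> triangle_free D -> triangle_free E.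
Proof.
move=> s tD [u [v [w [uvw [uv vw uw]]]]]; apply: tD; exists u, v, w; split=> //.
by split; apply: (adj_sub s).
Qed.

(** The set [T] is independent and sees only [N], so a triangle meeting [T] would have its other two
    vertices in [N], adjacent in [E]. *)
Lemma triangle_free_join E T N : [disjoint T & cover E] -> [disjoint T & N] ->
  independent E N -> triangle_free E -> triangle_free (E :|: join T N).
Proof.
move=> dE dN iN tE [u [v [w [uvw [uv vw uw]]]]].
have adjU x y : adj (E :|: join T N) x y ->
    [\/ [/\ adj E x y, x \notin T & y \notin T],
        [/\ x \in T, y \in N, x \notin N & y \notin T] |
        [/\ x \in N, y \in T, y \notin N & x \notin T]].
  rewrite /adj in_setU => /orP[xy|/adj_join[[xT yN]|[xN yT]]].
  - constructor 1; split=> //.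
      by rewrite (disjointFl dE) // (mem_cover xy) // set21.
    by rewrite (disjointFl dE) // (mem_cover xy) // set22.
  - by constructor 2; split=> //; [rewrite (disjointFr dN xT)|rewrite (disjointFl dN yN)].
  - by constructor 3; split=> //; [rewrite (disjointFr dN yT)|rewrite (disjointFl dN xN)].
(* Of the 27 cases, the membership conflicts leave a triangle inside [E] and the three with exactly
   one vertex in [T]. *)
case: (adjU _ _ uv) => [[a1 a2 a3]|[a1 a2 a3 a4]|[a1 a2 a3 a4]];
case: (adjU _ _ vw) => [[b1 b2 b3]|[b1 b2 b3 b4]|[b1 b2 b3 b4]];
case: (adjU _ _ uw) => [[c1 c2 c3]|[c1 c2 c3 c4]|[c1 c2 c3 c4]];
try by match goal with H : is_true ?b, H' : is_true (~~ ?b) |- _ =>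
  rewrite H in H' end.
- by apply: tE; exists u, v, w.
- by have := iN _ _ c1 b1; rewrite a1.
- by have := iN _ _ a2 c2; rewrite b1.
- by have := iN _ _ a1 b2; rewrite c1.
Qed.

Definition bounded_graph k E U : Prop :=
  [/\ simple E, arboric k E & cover E \subset U].

Lemma bounded_graph_join k E U T N : bounded_graph k E U -> N \subset U ->
  #|N| <= k -> [disjoint T & U] ->
  bounded_graph k (E :|: join T N) (T :|: U) /\
  #|E :|: join T N| = #|E| + #|T| * #|N|.
Proof.
move=> [sE aE cE] sN le dU.
have dN : [disjoint T & N] by apply: disjointWr dU.
have dE : [disjoint T & cover E] by apply: disjointWr dU.
split; last by rewrite cardUd ?card_join // disjoint_join.
split.
- by apply: simpleU => //; apply: simple_join.
- exact: arboric_join.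
rewrite coverU subUset (subset_trans cE) ?subsetUr //=.
by apply: subset_trans (cover_join _ _) _; apply: setUS.
Qed.

(** Division with remainder: [r %/ k] fresh vertices are joined to all of [N], and one more to
    [r %% k] vertices of [N]. The last one is counted in [U'] even if the remainder is 0. *)
Lemma bounded_graph_fill k E U N r : bounded_graph k E U -> N \subset U ->
  #|N| = k -> 0 < k -> #|U| + (r %/ k).+1 <= n ->
  exists E' U', [/\ bounded_graph k E' U', E \subset E', #|E'| = #|E| + r,
    #|U'| = #|U| + (r %/ k).+1 &
    triangle_free E -> independent E N -> triangle_free E'].
Proof.
move=> gE sN cN k0 room.
have [|T dT cT] := @fresh_vertices U (r %/ k); first by lia.
have [g1 c1] := bounded_graph_join gE sN (eq_leq cN) dT.
have cU1 : #|T :|: U| = #|U| + r %/ k by rewrite cardUd // cT addnC.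
have [|W dW cW] := @fresh_vertices (T :|: U) 1; first by rewrite cU1; lia.
have [|N' sN' cN'] := @subset_of_card N (r %% k); first by rewrite cN ltnW // ltn_mod.
have sN'1 : N' \subset T :|: U.
  by apply: subset_trans sN' _; apply: subset_trans sN _; apply: subsetUr.
have [|g2 c2] := bounded_graph_join g1 sN'1 _ dW; first by rewrite cN' ltnW // ltn_mod.
exists ((E :|: join T N) :|: join W N'), (W :|: (T :|: U)); split=> //.
- by rewrite -setUA subsetUl.
- by rewrite c2 c1 cT cN cW cN' mul1n -addnA -divn_eq.
- by rewrite cardUd // cW cU1; lia.
move=> tE iN; have [_ _ cE] := gE; have [_ _ cE1] := g1.
have dTN : [disjoint T & N] by apply: disjointWr dT.
apply: triangle_free_join.
- exact: disjointWr dW.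
- exact: disjointWr dW.
- move=> x y /(subsetP sN') xN /(subsetP sN') yN.
  rewrite /adj in_setU negb_or; apply/andP; split; first exact: iN.
  by apply/negP => /adj_join[[xT _]|[_ yT]];
    [have := disjointFr dTN xT; rewrite xN|have := disjointFr dTN yT; rewrite yN].
- by apply: triangle_free_join => //; apply: disjointWr dT.
Qed.

(** Farness in absolute numbers of edges. As [F] need not lie in [E], the notion is monotone in
    [E]. *)
Definition triangle_far p E : Prop :=
  forall F : {set {set 'I_n}}, triangle_free (E :\: F) -> p <= #|F|.

Lemma triangle_far_sub p E D : E \subset D -> triangle_far p E -> triangle_far p D.
Proof. by move=> s fE F tD; apply: fE; apply: triangle_free_sub tD; apply: setSD. Qed.

Lemma triangle_farU p q E D : [disjoint E & D] ->
  triangle_far p E -> triangle_far q D -> triangle_far (p + q) (E :|: D).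
Proof.
move=> dED fE fD F tF.
have cap (A : {set {set 'I_n}}) : A \subset E :|: D -> triangle_free (A :\: (F :&: A)).
  move=> s; apply: triangle_free_sub tF; apply/subsetP => e.
  rewrite !inE => /andP[]; rewrite negb_and => + eA.
  by rewrite eA orbF => ->; have := subsetP s e eA; rewrite inE => ->.
have /fE pE := cap E (subsetUl _ _).
have /fD qD := cap D (subsetUr _ _).
apply: leq_trans (leq_add pE qD) _; rewrite -cardUd -?setIUr.
  by apply: subset_leq_card; apply: subsetIl.
rewrite -setI_eq0 setIACA; move: dED; rewrite -setI_eq0 => /eqP->.
by rewrite setI0.
Qed.

Lemma enumerate_set A a : #|A| = a ->
  exists2 f : 'I_a -> 'I_n, injective f & forall i, f i \in A.
Proof.
move=> cA; exists (fun i => enum_val (cast_ord (esym cA) i)).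
  by move=> i j /enum_val_inj/cast_ord_inj.
by move=> i; apply: enum_valP.
Qed.

(* The triangles [A_i B_j C_(i+j)] are pairwise edge-disjoint. *)
Lemma triangle_far_tripartite A B C a :
  #|A| = a -> #|B| = a -> #|C| = a ->
  [disjoint B & A] -> [disjoint C & A] -> [disjoint C & B] ->
  triangle_far (a * a) (join B A :|: join C (B :|: A)).
Proof.
(* Indices are added modulo a, for which a has to be a successor. *)
case: a => [|a]; first by move=> *; move=> F _; rewrite mul0n.
move=> /enumerate_set[f fI fA] /enumerate_set[g gI gB] /enumerate_set[h hI hC].
move=> dBA dCA dCB F tF.
have BA i j : g i = f j -> False.
  by move=> e; have := disjointFr dBA (gB i); rewrite e fA.
have CA i j : h i = f j -> False.
  by move=> e; have := disjointFr dCA (hC i); rewrite e fA.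
have CB i j : h i = g j -> False.
  by move=> e; have := disjointFr dCB (hC i); rewrite e gB.
(* [t] picks from each triangle an edge in [F], the third one by default. An edge shared by two
   triangles fixes two of i, j, i + j, hence both indices, so [t] is injective. *)
pose t (p : 'I_a.+1 * 'I_a.+1) : {set 'I_n} :=
  if [set f p.1; g p.2] \in F then [set f p.1; g p.2] else
  if [set f p.1; h (p.1 + p.2)%R] \in F then [set f p.1; h (p.1 + p.2)%R]
  else [set g p.2; h (p.1 + p.2)%R].
have tI : injective t.
  move=> [i j] [i' j']; rewrite /t /=; do !case: ifP => _; move/eq_set2.
  - by case=> -[]; [move=> /fI-> /gI->|move=> /esym/BA].
  - by case=> -[]; [move=> _ /esym/CB|move=> /esym/CA].
  - by case=> -[]; [move=> /esym/BA|move=> /esym/CA].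
  - by case=> -[]; [move=> _ /CB|move=> /esym/BA].
  - by case=> -[]; [move=> /fI-> /hI/addrI->|move=> /esym/CA].
  - by case=> -[]; [move=> /esym/BA|move=> /esym/CA].
  - by case=> -[]; [move=> /BA|move=> _ /CA].
  - by case=> -[]; [move=> /BA|move=> _ /CA].
  - by case=> -[]; [move=> /gI-> /hI/addIr->|move=> /esym/CB].
have tF' p : t p \in F.
  case: p => i j; rewrite /t /=; case: ifP => // n1; case: ifP => // n2.
  apply: contrapT => /negP n3; apply: tF; exists (f i), (g j), (h (i + j)%R).
  split; first by split; apply/eqP => e; [case: (BA j i)|case: (CB (i + j)%R j)|
    case: (CA (i + j)%R i)].
  rewrite /adj !in_setD n1 n2 n3 /=; split; rewrite inE.
  - by apply/orP; left; apply/joinP; exists (g j), (f i); split=> //; apply: setUC.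
  - apply/orP; right; apply/joinP; exists (h (i + j)%R), (g j); split=> //.
      by rewrite in_setU gB.
    exact: setUC.
  - apply/orP; right; apply/joinP; exists (h (i + j)%R), (f i); split=> //.
      by rewrite in_setU fA orbT.
    exact: setUC.
have -> : a.+1 * a.+1 = #|t @: [set: 'I_a.+1 * 'I_a.+1]|.
  by rewrite card_imset // cardsT card_prod !card_ord.
by apply: subset_leq_card; apply/subsetP => e /imsetP[p _ ->].
Qed.

(** One part [A] of a copy of K_(a,a,a) is taken among the old vertices; the fresh part [B] is
    joined to [A], then the fresh part [C] to both. Each new vertex is joined to at most 2a <= k
    vertices, and the cost is a^2 + 2a^2 edges. *)
Lemma bounded_graph_tripartite k E U p a : bounded_graph k E U ->
  a.*2 <= k -> a <= #|U| -> #|U| + a.*2 <= n -> triangle_far p E ->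
  exists E' U', [/\ bounded_graph k E' U', E \subset E',
    #|E'| = #|E| + 3 * (a * a), U \subset U' /\ #|U'| = #|U| + a.*2 &
    triangle_far (p + a * a) E'].
Proof.
move=> gE ak aU room fE.
have [A sA cA] := subset_of_card aU.
have [|B dB cB] := @fresh_vertices U a; first by lia.
have leA : #|A| <= k by lia.
have [g1 c1] := bounded_graph_join gE sA leA dB.
have cU1 : #|B :|: U| = #|U| + a by rewrite cardUd // cB addnC.
have [|C dC cC] := @fresh_vertices (B :|: U) a; first by rewrite cU1; lia.
have sBA : B :|: A \subset B :|: U by apply: setUS.
have dBA : [disjoint B & A] by apply: disjointWr dB.
have cBA : #|B :|: A| = a.*2 by rewrite cardUd // cA cB addnn.
have [|g2 c2] := bounded_graph_join g1 sBA _ dC; first by rewrite cBA.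
exists ((E :|: join B A) :|: join C (B :|: A)), (C :|: (B :|: U)); split=> //.
- by rewrite -setUA subsetUl.
- by rewrite c2 c1 cB cA cC cBA; lia.
- by rewrite cardUd // cC cU1; split; [rewrite setUA subsetUr|lia].
have [_ _ cE] := gE.
have dC' (X : {set 'I_n}) : X \subset B :|: U -> [disjoint C & X].
  by move=> s; apply: disjointWr s dC.
rewrite -setUA; apply: triangle_farU => //.
  rewrite -setI_eq0 setIUr setU_eq0 !setI_eq0 !disjoint_join //.
    by apply: dC'; apply: subset_trans cE _; apply: subsetUr.
  exact: disjointWr dB.
apply: triangle_far_tripartite => //; apply: dC'.
  by apply: subset_trans sA _; apply: subsetUr.
exact: subsetUl.
Qed.

Lemma bounded_graph_tripartites k E U a c : bounded_graph k E U ->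
  a.*2 <= k -> a <= #|U| -> #|U| + c * a.*2 <= n ->
  exists E' U', [/\ bounded_graph k E' U', E \subset E',
    #|E'| = #|E| + c * (3 * (a * a)), U \subset U' /\ #|U'| = #|U| + c * a.*2 &
    triangle_far (c * (a * a)) E'].
Proof.
move=> gE ak aU; elim: c => [|c IH] room.
  by exists E, U; split=> //; rewrite !mul0n !addn0.
have [|E1 [U1 [g1 s1 c1 [sU1 cU1] f1]]] := IH; first by move: room; rewrite mulSn; lia.
have [|//|E2 [U2 [g2 s2 c2 [sU2 cU2] f2]]] := bounded_graph_tripartite g1 ak _ _ f1.
- exact: leq_trans aU (subset_leq_card sU1).
- by move: room; rewrite cU1 mulSn; lia.
exists E2, U2; split=> //.
- exact: subset_trans s2.
- by rewrite c2 c1 mulSn; lia.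
- by split; [apply: subset_trans sU2|rewrite cU2 cU1 mulSn; lia].
- by rewrite mulSn addnC.
Qed.

Definition clique (S : {set 'I_n}) : {set {set 'I_n}} :=
  [set e : {set 'I_n} | (e \subset S) && (#|e| == 2)].

Lemma clique_simple S : simple (clique S).
Proof. by move=> e; rewrite inE => /andP[_ /eqP]. Qed.

Lemma clique_cover S : cover (clique S) \subset S.
Proof.
by apply/subsetP => x /bigcupP[e]; rewrite inE => /andP[/subsetP s _] /s.
Qed.

Lemma clique_card S : #|clique S| = 'C(#|S|, 2).
Proof. by rewrite /clique cards_draws. Qed.

(** A forest on 2k + 1 vertices has at most 2k edges, so k forests have at most 2k^2 < k (2k + 1) of
    them. *)
Lemma clique_not_arboric k S : 0 < k -> #|S| = k.*2.+1 -> ~ arboric k (clique S).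
Proof.
move=> k0 cS [F [fF cF]].
pose G i := F i :&: clique S.
have le1 : #|clique S| <= \sum_(i < k) #|G i|.
  apply: (@leq_trans #|\bigcup_(i < k) G i|).
    apply/subset_leq_card/subsetP => e eS; have [i ei] := cF e eS.
    by apply/bigcupP; exists i => //; rewrite inE ei.
  elim/big_rec2: _ => [|i m W _ le]; first by rewrite cards0.
  by apply: leq_trans (leq_card_setU _ _) _; rewrite leq_add2l.
have le2 : \sum_(i < k) #|G i| <= \sum_(i < k) k.*2.
  apply: leq_sum => i _; rewrite -ltnS -cS.
  have sG : G i \subset clique S := subsetIr _ _.
  apply: forest_card.
  - by apply: forest_sub (fF i); apply: subsetIl.
  - by apply: subset_trans (clique_cover S); apply: coverS.
  - by move=> e /(subsetP sG)/clique_simple.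
  - by rewrite -card_gt0 cS.
move: (leq_trans le1 le2); rewrite clique_card cS sum_nat_const card_ord bin2 /=.
rewrite -doubleMr; nia.
Qed.

End Extensions.

(** * Saving edges by splitting off vertices of low degree *)

Section Sparse.
Local Open Scope nat_scope.
Local Open Scope set_scope.
Variable n : nat.
Implicit Types (E D : {set {set 'I_n}}) (u v x y : 'I_n) (N T U : {set 'I_n})
  (M : seq ('I_n * 'I_n)).

Definition pair_edges M : {set {set 'I_n}} := [set [set p.1; p.2] | p in M].

Lemma mem_endpoints M p : p \in M -> p.1 \in endpoints M /\ p.2 \in endpoints M.
Proof.
have e : endpoints M = flatten [seq [:: p.1; p.2] | p <- M] by [].
move=> pM; split; rewrite e; apply/flattenP; exists [:: p.1; p.2];
  by rewrite ?inE ?eqxx ?orbT // (map_f (fun p : 'I_n * 'I_n => [:: p.1; p.2])).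
Qed.

Lemma adj_pair_edges M x y : adj (pair_edges M) x y ->
  x \in endpoints M /\ y \in endpoints M.
Proof.
case/imsetP => p /mem_endpoints[p1 p2] /eq_set2[[-> ->]|[-> ->]] //.
Qed.

Lemma pair_edges_cons p M : pair_edges (p :: M) = [set p.1; p.2] |: pair_edges M.
Proof.
apply/setP => e; rewrite in_setU1; apply/imsetP/orP => [[q]|].
  rewrite inE => /orP[/eqP->->|qM ->]; first by left.
  by right; apply/imsetP; exists q.
case=> [/eqP->|/imsetP[q qM ->]]; first by exists p; rewrite // mem_head.
by exists q => //; rewrite inE qM orbT.
Qed.

Lemma simple_pair_edges M : uniq (endpoints M) -> simple (pair_edges M).
Proof.
elim: M => [_ e /imsetP[]//|[a b] M IH].
rewrite -[endpoints _]/(a :: b :: endpoints M) pair_edges_cons.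
move=> /= /andP[+ /andP[_ /IH sM]]; rewrite inE negb_or => /andP[ab _] e.
by rewrite in_setU1 => /orP[/eqP->|/sM//]; rewrite cards2 ab.
Qed.

Lemma card_pair_edges M : #|pair_edges M| <= size M.
Proof. by apply: leq_trans (leq_imset_card _ _) _; apply: card_size. Qed.

Lemma matching_degree M x : uniq (endpoints M) -> #|nbrs_in (pair_edges M) x| <= 1.
Proof.
elim: M => [_|[a b] M IH].
  rewrite (_ : nbrs_in _ _ = set0) ?cards0 //.
  by apply/setP => y; rewrite !inE; apply/negP => /imsetP[].
rewrite -[endpoints _]/(a :: b :: endpoints M) pair_edges_cons.
move=> /= /andP[+ /andP[bM /IH dM]]; rewrite inE negb_or => /andP[ab aM].
have [xab|xab] := boolP (x \in [set a; b]).
  apply: (@leq_trans #|[set if x == a then b else a]|); last by rewrite cards1.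
  apply/subset_leq_card/subsetP => y; rewrite !inE.
  case/adjU1=> [/adj_pair_edges[xM _]|[-> ->]|[-> ->]].
  - by move: xM; case/set2P: xab => ->; rewrite ?(negPf aM) ?(negPf bM).
  - by rewrite eqxx.
  - by rewrite (eq_sym b) (negPf ab).
apply: leq_trans dM; apply/subset_leq_card/subsetP => y; rewrite !inE.
by case/adjU1 => // -[xE _]; move: xab; rewrite xE ?set21 ?set22.
Qed.

(** Greedy choice: [x] and its at most i neighbours in [N] do not exhaust [N]; a remaining [y] is
    paired with [x], and both are removed. *)
Lemma nonadjacent_matching (e : rel 'I_n) i j N :
  (forall x, x \in N -> #|[set y in N | e x y]| <= i) -> j.*2 + i <= #|N| ->
  exists M, [/\ size M = j, uniq (endpoints M), {subset endpoints M <= N} &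
                forall p, p \in M -> ~~ e p.1 p.2].
Proof.
elim: j N => [|j IH] N dN le; first by exists [::].
have /card_gt0P[x xN] : 0 < #|N| by lia.
pose B := [set y in N | e x y].
have leB : #|B| <= i := dN x xN.
have : 0 < #|N :\: (x |: B)|.
  rewrite cardsD; have := subset_leq_card (subsetIr N (x |: B)).
  rewrite cardsU1; have := leq_b1 (x \notin B).
  move: le leB; move: (#|B|) (#|N|) (#|_ :&: _|) (x \notin B : nat); clear; lia.
case/card_gt0P => y; rewrite !inE negb_or => /andP[/andP[yx +] yN].
rewrite yN /= => exy.
have [||M [sM uM iM nM]] := IH (N :\: [set x; y]).
- move=> z; rewrite in_setD => /andP[_ zN]; apply: leq_trans (dN z zN).
  by apply/subset_leq_card/subsetP => w; rewrite !inE => /andP[/andP[_ ->] ->].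
- rewrite cardsD; have := subset_leq_card (subsetIr N [set x; y]).
  rewrite cards2; have := leq_b1 (x != y).
  move: le; move: (#|N|) (#|_ :&: _|) (x != y : nat); clear; lia.
exists ((x, y) :: M); rewrite -[endpoints _]/(x :: y :: endpoints M) /=; split.
- by rewrite sM.
- rewrite inE negb_or eq_sym yx uM andbT /=; apply/andP; split.
    by apply/negP => /iM; rewrite !inE eqxx.
  by apply/negP => /iM; rewrite !inE eqxx orbT.
- move=> z; rewrite !inE => /or3P[/eqP->|/eqP->|/iM] //.
  by rewrite inE => /andP[].
- by move=> p; rewrite inE => /orP[/eqP->|/nM].
Qed.

(* Each splitting-off step trades the [deg t] edges at [t] for [deg t - k] edges;
   [i] bounds the number of edges added so far at a vertex. *)
Lemma split_off_independent k E i (ts : seq 'I_n) : simple E -> ~ arboric k E ->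
  uniq ts ->
  (forall t, t \in ts -> k < #|nbrs_in E t| <= k.*2.+1 - (i + size ts)) ->
  (forall t t', t \in ts -> t' \in ts -> ~~ adj E t t') ->
  (forall t x, t \in ts -> x \in nbrs_in E t -> #|nbrs_in E x :&: nbrs_in E t| <= i) ->
  exists D, [/\ simple D, ~ arboric k D, #|D| + size ts * k <= #|E| &
                cover D \subset cover E].
Proof.
elim: ts i E => [|v ts IH] i E sE nE uts dE iE cE.
  by exists E; rewrite mul0n addn0.
have /andP[vts uts'] : (v \notin ts) && uniq ts := uts.
have vin : v \in v :: ts by rewrite mem_head.
have tin t : t \in ts -> t \in v :: ts by move=> tt; rewrite inE tt orbT.
have /andP[d1 d2] := dE v vin.
set N := nbrs_in E v; set d := #|N|; rewrite -/N -/d in d1 d2.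
(* A matching of d - k non-edges in [N] requires 2 (d - k) + i <= d, that is d <= 2k - i; this
   follows from the degree hypothesis, as the list has length at least 1. *)
have [||M [sM uM iM nM]] := @nonadjacent_matching (adj E) i (d - k) N.
- move=> x xN; apply: leq_trans (cE v x vin xN); apply/subset_leq_card/subsetP => y.
  by rewrite -/N !inE => /andP[-> ->].
- by move: d1 d2; rewrite -/d /=; clear; lia.
pose E1 := del_vertex E v :|: pair_edges M.
have sE1 : simple E1.
  apply: simpleU; last exact: simple_pair_edges.
  by apply: simple_sub sE; apply: del_vertex_sub.
have nE1 : ~ arboric k E1.
  move=> aE1; apply: nE; apply: (@arboric_split _ _ _ v M) => //.
  by rewrite sM -/N -/d; lia.
have tM t : t \in ts -> t \notin endpoints M.
  move=> tts; apply/negP => /iM; rewrite inE; apply/negP; apply: iE => //.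
  exact: tin.
have nbrsE t : t \in ts -> nbrs_in E1 t = nbrs_in E t.
  move=> tts; apply/setP => y; rewrite !inE /E1 /adj in_setU.
  apply/orP/idP => [[|/adj_pair_edges[]]|tyE].
  - by rewrite inE => /andP[].
  - by rewrite (negPf (tM t tts)).
  - left; rewrite inE tyE /=; apply/negP => /set2P[vt|vy].
      by move: vts; rewrite vt tts.
    by have := iE t v (tin t tts) vin; rewrite /adj vy tyE.
(* The remaining vertices avoid [v] and the ends of [M], so they keep their neighbourhoods; the
   matching adds at most one edge at each vertex, which raises i by one. *)
have [|t t' tts t'ts|t x tts|D [sD nD cD cvD]] := IH i.+1 E1 sE1 nE1 uts'.
- move=> t tts; rewrite nbrsE //; have /andP[-> /=] := dE t (tin t tts).
  by rewrite addnS addSn.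
- have : t' \notin nbrs_in E1 t by rewrite nbrsE // inE; apply: iE; apply: tin.
  by rewrite inE.
- rewrite nbrsE // => xt.
  apply: (@leq_trans #|(nbrs_in E x :&: nbrs_in E t) :|: nbrs_in (pair_edges M) x|).
    apply/subset_leq_card/subsetP => y; rewrite !inE => /andP[+ ->]; rewrite andbT.
    rewrite /adj in_setU => /orP[|->]; last by rewrite orbT.
    by rewrite inE => /andP[-> _].
  apply: leq_trans (leq_card_setU _ _) _; rewrite -addn1.
  by apply: leq_add; [apply: cE => //; apply: tin|apply: matching_degree].
exists D; split=> //.
- have arith (a b c e f g h : nat) : h + k = d -> b + d = a -> g <= h -> c <= b + g ->
      e + f <= c -> e + (k + f) <= a by clear; lia.
  rewrite /= mulSn; apply: arith (card_del_vertex v sE) _ (leq_card_setU _ _) cD.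
    exact: subnK (ltnW d1).
  by rewrite -sM; apply: card_pair_edges.
- apply: subset_trans cvD _; rewrite coverU subUset coverS ?del_vertex_sub //=.
  apply/subsetP => x /bigcupP[e /imsetP[p /mem_endpoints[p1 p2] ->]].
  by case/set2P => ->; [move/iM: p1|move/iM: p2]; rewrite inE => vx;
    apply: (mem_cover vx); rewrite set22.
Qed.

Lemma triangle_free_nbrs E u : simple E -> triangle_free E -> independent E (nbrs_in E u).
Proof.
move=> sE tE x y; rewrite !inE => ux uy; apply/negP => xy; apply: tE.
have irr a b : adj E a b -> a != b.
  by move=> ab; apply/eqP => e; move/sE: ab; rewrite e setUid cards1.
by exists u, x, y; split; split=> //; apply: irr.
Qed.

Lemma nbrs_cover E u x : x \in nbrs_in E u -> (u \in cover E) * (x \in cover E).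
Proof. by rewrite inE => ux; split; apply: (mem_cover ux); rewrite ?set21 ?set22. Qed.

(* If there is no such [u], the subgraph induced by the vertices of high degree is
   triangle-free of minimum degree at least [2 (k - s)]. *)
Lemma low_degree_nbrs k s E : simple E -> triangle_free E -> 0 < #|cover E| ->
  s <= k -> (forall v, v \in cover E -> k < #|nbrs_in E v|) ->
  #|E| < ((k - s).*2) ^ 2 ->
  exists u, s <= #|nbrs_in E u :&: [set v | #|nbrs_in E v| <= k.*2.+1 - s]|.
Proof.
move=> sE tE /card_gt0P[w wE] sk dE cE; apply: contrapT => no.
pose U := [set v | k.*2.+1 - s < #|nbrs_in E v|].
have high u : #|nbrs_in E u| < #|nbrs_in E u :&: U| + s.
  have lt : #|nbrs_in E u :&: [set v | #|nbrs_in E v| <= k.*2.+1 - s]| < s.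
    by rewrite ltnNge; apply/negP => le; apply: no; exists u.
  have := cardsID U (nbrs_in E u).
  rewrite (_ : nbrs_in E u :\: U = nbrs_in E u :&: [set v | #|nbrs_in E v| <= k.*2.+1 - s]).
    by move: lt; move: (#|_|) (#|_|) (#|_|); clear; lia.
  by apply/setP => v; rewrite in_setD in_setI !in_set -leqNgt andbC.
pose c := (k - s).*2.
have dU u : u \in U -> c <= #|nbrs_in E u :&: U|.
  by rewrite inE => uU; move: uU (high u) sk; rewrite /c; move: (#|_|) (#|_|); clear; lia.
have [u uU] : exists u, u \in U.
  have : 0 < #|nbrs_in E w :&: U|.
    by move: (high w) (dE w wE) sk; move: (#|_|) (#|_|); clear; lia.
  by case/card_gt0P => u; rewrite inE => /andP[_ uU]; exists u.
have [c0|c0] := posnP c; first by move: cE; rewrite -/c c0.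
have /card_gt0P[v] : 0 < #|nbrs_in E u :&: U| by apply: leq_trans (dU u uU).
rewrite inE => /andP[uv vU].
(* Adjacent [u] and [v] have disjoint neighbourhoods, so [U] has at least 2c vertices; as each has
   degree at least c, this gives c^2 <= |E|. *)
have cU : c + c <= #|U|.
  apply: leq_trans (leq_add (dU u uU) (dU v vU)) _; rewrite -cardUd.
    by apply: subset_leq_card; rewrite -setIUl subsetIr.
  rewrite -setI_eq0; apply/eqP/setP => x; rewrite in_set0; apply/negP.
  rewrite !in_setI => /andP[/andP[ux _] /andP[vx _]].
  by have := triangle_free_nbrs sE tE uv ux; move: vx; rewrite inE => ->.
have : (c + c) * c <= #|E|.*2.
  rewrite -handshake //; apply: leq_trans (leq_mul cU (leqnn c)) _.
  rewrite -sum_nat_const [leqRHS](bigID (mem U)) /=; apply: leq_trans (leq_addr _ _).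
  apply: leq_sum => x xU; apply: leq_trans (dU x xU) _.
  by apply: subset_leq_card; apply: subsetIl.
by move: cE; rewrite -/c -mulnn mulnDl addnn leq_double ltnNge => /negPf->.
Qed.

(** The s low-degree neighbours of one vertex are pairwise non-adjacent, and the neighbourhood of
    each is independent. So they can be split off starting with i = 0, saving k edges each. *)
Lemma cheap_non_arboric k s E : simple E -> triangle_free E -> ~ arboric k E ->
  s <= k -> (forall v, v \in cover E -> k < #|nbrs_in E v|) ->
  #|E| < ((k - s).*2) ^ 2 ->
  exists D, [/\ simple D, ~ arboric k D, #|D| + s * k <= #|E| &
                cover D \subset cover E].
Proof.
move=> sE tE nE sk dE cE.
have c0 : 0 < #|cover E|.
  rewrite lt0n; apply/eqP => /cards0_eq cE0; apply: nE.
  rewrite (_ : E = set0); first exact: arboric0.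
  apply/setP => e; rewrite in_set0; apply/negP => eE.
  have /eqP/cards2P[x [y [_ ee]]] := sE e eE.
  have : x \in cover E by rewrite (mem_cover eE) // ee set21.
  by rewrite cE0 inE.
have [u us] := low_degree_nbrs sE tE c0 sk dE cE.
have [T sT cT] := subset_of_card us.
have [tN tL] : {subset T <= nbrs_in E u} /\
    forall t, t \in T -> #|nbrs_in E t| <= k.*2.+1 - s.
  by split=> t /(subsetP sT)/setIP[tu tl] //; move: tl; rewrite in_set.
have szT : size (enum T) = s by rewrite -cardE.
have := @split_off_independent k E 0 (enum T) sE nE (enum_uniq _).
rewrite szT; apply.
- by move=> t; rewrite mem_enum => tT; rewrite dE ?tL //; case: (nbrs_cover (tN t tT)).
- move=> t t'; rewrite !mem_enum => /tN tT /tN t'T.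
  exact: triangle_free_nbrs tT t'T.
- move=> t x _ xt; rewrite leqn0 cards_eq0; apply/eqP/setP => y.
  rewrite in_set0; apply/negP => /setIP[xy ty].
  by have := triangle_free_nbrs sE tE xt ty; move: xy; rewrite inE => ->.
Qed.

End Sparse.

(** * Triangle-free and far graphs on O(m / Gamma) vertices *)

Section SparseFamilies.
Local Open Scope nat_scope.
Local Open Scope set_scope.
Variable n : nat.
Implicit Types (E D X : {set {set 'I_n}}) (u v x y : 'I_n) (N T U : {set 'I_n}).

Lemma arboric1_triangle_free E : arboric 1 E -> triangle_free E.
Proof.
move=> [F [fF cF]] [u [v [w [[uv vw uw] [Euv Evw Euw]]]]].
have sE : E \subset F ord0.
  by apply/subsetP => e /cF[i]; rewrite (ord1 i).
have /(forest_sub sE (fF ord0)) // : ucycle (adj E) [:: u; v; w].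
by rewrite /ucycle /= Euv Evw adjC Euw !inE negb_or uv uw vw.
Qed.

Lemma critical_card_cover k E : simple E -> ~ arboric k E ->
  (forall v, v \in cover E -> k < #|nbrs_in E v|) ->
  k.+1 < #|cover E| /\ #|cover E| * k.+1 <= #|E|.*2.
Proof.
move=> sE nE dE; split; last exact: min_degree_cover.
have [E0|[e eE]] := set_0Vmem E; first by rewrite E0 in nE; case: nE; apply: arboric0.
have /eqP/cards2P[x [y [_ ee]]] := sE e eE.
have xE : x \in cover E by rewrite (mem_cover eE) // ee set21.
have xN := simple_nbrs_irr x sE.
apply: (@leq_trans #|x |: nbrs_in E x|); first by rewrite cardsU1 xN ltnS dE.
apply/subset_leq_card/subsetP => z; rewrite in_setU1 => /orP[/eqP->//|].
by move=> /nbrs_cover[].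
Qed.

Lemma sparse_triangle_free k m E : simple E -> #|E| = m -> triangle_free E ->
  ~ arboric k E -> 5 * m <= k.+1 * n ->
  exists E' U, [/\ bounded_graph k.+1 E' U, ~ arboric k E', #|E'| = m,
    #|U| * k.+1 <= 5 * m & triangle_free E'].
Proof.
move=> sE cE tE nE room.
have [H [sHE nH aH dH]] := arboric_critical sE nE.
have sH := simple_sub sHE sE.
have tH := triangle_free_sub sHE tE.
have [c1 c2] := critical_card_cover sH nH dH.
have leH : #|H| <= m by rewrite -cE subset_leq_card.
have /card_gt0P[v vH] : 0 < #|cover H| by apply: leq_trans c1.
have [N sN cN] := subset_of_card (dH v vH).
have gH : bounded_graph k.+1 H (cover H) by [].
pose r := m - #|H|.
have rk : r %/ k.+1 * k.+1 <= r := leq_divM _ _.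
(* By its minimum degree [H] contributes 2|H|; the filling contributes at most m - |H|, and the
   extra vertex k + 1 <= 2|H|. *)
have cU : (#|cover H| + (r %/ k.+1).+1) * k.+1 <= 5 * m.
  rewrite mulnDl mulSn; move: c1 c2 leH rk; rewrite /r.
  move: (#|cover H|) (#|H|) (_ %/ _ * _); clear; nia.
have sN' : N \subset cover H.
  by apply/subsetP => x /(subsetP sN)/nbrs_cover[].
have [|E' [U [gE' sE' cE' cU' tE']]] := bounded_graph_fill (r := r) gH sN' cN isT.
  by rewrite -(leq_pmul2r (ltn0Sn k)) (mulnC n); apply: leq_trans cU room.
exists E', U; split=> //.
- by move/(arboric_sub sE').
- by rewrite cE' /r subnKC.
- by rewrite cU'.
- apply: tE' => // x y /(subsetP sN) xN /(subsetP sN) yN.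
  exact: triangle_free_nbrs xN yN.
Qed.

(** A critical subgraph of [X] forces arboricity above k, copies of K_(a,a,a) provide the farness,
    and joins to a set of k + 1 vertices bring the number of edges to exactly m. None of these joins
    raises the arboricity above k + 1. *)
Lemma dense_completion k X U a c m : simple X -> ~ arboric k X ->
  cover X \subset U -> k < #|U| -> a.*2 <= k.+1 -> #|X| + c * (3 * (a * a)) <= m ->
  #|U| + c * a.*2 + (m %/ k.+1).+1 <= n ->
  exists E' U', [/\ bounded_graph k.+1 E' U', ~ arboric k E', #|E'| = m,
    #|U'| <= #|U| + c * a.*2 + (m %/ k.+1).+1 & triangle_far (c * (a * a)) E'].
Proof.
move=> sX nX cX kU ak cm room.
have [H [sHX nH aH _]] := arboric_critical sX nX.
have leH := subset_leq_card sHX.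
have gH : bounded_graph k.+1 H U.
  split=> //; first exact: simple_sub sHX sX.
  by apply: subset_trans cX; apply: coverS.
have [||E1 [U1 [g1 s1 c1 [sU1 cU1] f1]]] := bounded_graph_tripartites (c := c) gH ak.
- by move: ak kU; rewrite -addnn; move: (#|U|); clear; lia.
- by apply: leq_trans room; apply: leq_addr.
have [N sN cN] := subset_of_card (leq_trans kU (subset_leq_card sU1)).
have leE1 : #|E1| <= m by rewrite c1; apply: leq_trans cm; rewrite leq_add2r.
have rm : (m - #|E1|) %/ k.+1 <= m %/ k.+1 by apply: leq_div2r; apply: leq_subr.
have [|E' [U' [gE' sE' cE' cU' _]]] := bounded_graph_fill (r := m - #|E1|) g1 sN cN isT.
  by rewrite cU1; apply: leq_trans room; rewrite leq_add2l.
exists E', U'; split=> //.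
- by move/(arboric_sub sE')/(arboric_sub s1).
- by rewrite cE' subnKC.
- by rewrite cU' cU1 leq_add2l.
- exact: triangle_far_sub f1.
Qed.

Lemma sparse_far_large k m : 0 < k -> 3 * k.+1 ^ 2 <= m -> 5 * m <= k.+1 * n ->
  exists E U p, [/\ bounded_graph k.+1 E U, ~ arboric k E, #|E| = m,
    #|U| * k.+1 <= 5 * m /\ m < 64 * (64 * p) & triangle_far p E].
Proof.
move=> k0 mk room.
have [|S _ cS] := @fresh_vertices n set0 k.*2.+1.
  rewrite cards0 add0n -(leq_pmul2l (ltn0Sn k)); apply: leq_trans room.
  by move: mk; rewrite -mulnn -muln2; clear; nia.
have sS := @clique_simple n S.
have nS := clique_not_arboric k0 cS.
have cardS : #|clique S| = k * k.*2.+1.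
  rewrite clique_card cS bin2 /= -muln2; nia.
pose a := k.+1./2; pose t := 3 * (a * a).
have a0 : 0 < a by rewrite /a; lia.
have a2 : a.*2 <= k.+1 by rewrite /a; lia.
have a3 : k.+1 <= 3 * a by rewrite /a; lia.
pose r := m - #|clique S|; pose c := r %/ t.
(* The clique has k (2k + 1) <= 2 Gamma^2 <= 2m / 3 edges, which leaves at least m / 3 for the
   copies of K_(a,a,a), each costing t edges. *)
have mr : m <= 3 * r by rewrite /r cardS; move: mk; rewrite -mulnn -muln2; clear; nia.
have Sm : #|clique S| <= m by rewrite cardS; move: mk; rewrite -mulnn -muln2; clear; nia.
have t0 : 0 < t by rewrite /t !muln_gt0 a0.
have tr : t <= r by move: a2 mk mr; rewrite /t -mulnn -muln2; clear; nia.
have ct : c * t <= r := leq_divM _ _.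
have rc : r < c.+1 * t by rewrite ltn_ceil.
have c0 : 0 < c by rewrite divn_gt0.
have mkk : m %/ k.+1 * k.+1 <= m := leq_divM _ _.
have cU : (#|S| + c * a.*2 + (m %/ k.+1).+1) * k.+1 <= 5 * m.
  have h1 : #|S| * k.+1 + k.+1 <= m.
    by rewrite cS; move: mk; rewrite -mulnn -muln2; clear; nia.
  have h2 : c * a.*2 * k.+1 <= 2 * m.
    have : c * a.*2 * k.+1 <= 2 * (c * t).
      rewrite /t; have -> : 2 * (c * (3 * (a * a))) = c * a.*2 * (3 * a) by rewrite -muln2; lia.
      by rewrite leq_mul2l a3 orbT.
    by move: ct; rewrite /r; clear; lia.
  have arith (x y z : nat) : x + k.+1 <= m -> y <= 2 * m -> z <= m ->
      x + y + (k.+1 + z) <= 5 * m by clear; lia.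
  by rewrite 2!mulnDl mulSn; apply: arith.
have [||||E [U [gE nE cE cU' fE]]] :=
  dense_completion (a := a) (c := c) (m := m) sS nS (clique_cover S).
- by rewrite cS -addnn; clear; lia.
- by [].
- by move: ct; rewrite -/t /r; lia.
- by rewrite -(leq_pmul2r (ltn0Sn k)) (mulnC n); apply: leq_trans cU room.
exists E, U, (c * (a * a)); split=> //; split.
  by apply: leq_trans cU; rewrite leq_mul2r cU' orbT.
(* At least one copy fits, so r < 2ct, and m <= 3r < 18p for p = c a^2. *)
have : r < 2 * (c * t) by move: rc; rewrite mulSn; move: c0; clear; nia.
by move: mr; rewrite /t; clear; nia.
Qed.

Lemma sparse_far_small k m E : simple E -> #|E| = m -> triangle_free E ->
  ~ arboric k E -> 16 <= k.+1 -> m < 3 * k.+1 ^ 2 -> 5 * m <= k.+1 * n ->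
  exists E' U p, [/\ bounded_graph k.+1 E' U, ~ arboric k E', #|E'| = m,
    #|U| * k.+1 <= 5 * m /\ m < 64 * (64 * p) & triangle_far p E'].
Proof.
move=> sE cE tE nE k16 mk room.
have [H [sHE nH aH dH]] := arboric_critical sE nE.
have sH := simple_sub sHE sE.
have tH := triangle_free_sub sHE tE.
have [c1 c2] := critical_card_cover sH nH dH.
have leH : #|H| <= m by rewrite -cE subset_leq_card.
(* As Gamma >= 16, this choice gives k - s >= 7 Gamma / 8, hence (2 (k - s))^2 >= 49 Gamma^2 / 16 >
   3 Gamma^2 > m. *)
pose s := k.+1 %/ 16.
have s1 : s * 16 <= k.+1 := leq_divM _ _.
have s2 : k.+1 < s.+1 * 16 by rewrite ltn_ceil.
have s0 : 0 < s by rewrite divn_gt0.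
have sk : s <= k by lia.
have [|X [sX nX cX cvX]] := cheap_non_arboric sH tH nH sk dH.
  apply: leq_ltn_trans leH _; apply: leq_trans mk _.
  have : 7 * k.+1 <= 8 * (k - s) by lia.
  by rewrite -!mulnn -muln2; move: (k - s) k.+1; clear; nia.
have mkk : m %/ k.+1 * k.+1 <= m := leq_divM _ _.
have cU : (#|cover H| + 1 * s.*2 + (m %/ k.+1).+1) * k.+1 <= 5 * m.
  have h2 : s.*2 * k.+1 + k.+1 <= m.
    have h : k.+1 * k.+2 <= m.*2.
      apply: leq_trans (_ : #|H|.*2 <= _); last by rewrite leq_double.
      by apply: leq_trans c2; rewrite mulnC leq_mul2r c1 orbT.
    have : 16 * (s.*2 * k.+1) <= 2 * (k.+1 * k.+1).
      by rewrite -muln2; move: s1; clear; nia.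
    by move: h k16; clear; nia.
  have arith (x y z h : nat) : y + k.+1 <= m -> z <= m -> x <= h.*2 -> h <= m ->
      x + y + (k.+1 + z) <= 5 * m by clear; lia.
  by rewrite mul1n 2!mulnDl mulSn; apply: arith c2 leH.
have [||||E' [U [gE' nE' cE' cU' fE']]] :=
  dense_completion (a := s) (c := 1) (m := m) sX nX cvX.
- exact: ltnW.
- by rewrite -muln2; lia.
(* The s k edges saved by splitting off pay for the 3 s^2 edges of one copy of K_(s,s,s). *)
- apply: leq_trans leH; apply: leq_trans cX; rewrite leq_add2l mul1n mulnA.
  by rewrite mulnC leq_mul2l; apply/orP; right; lia.
- by rewrite -(leq_pmul2r (ltn0Sn k)) (mulnC n); apply: leq_trans cU room.
exists E', U, (1 * (s * s)); split=> //; split.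
  by apply: leq_trans cU; rewrite leq_mul2r cU' orbT.
rewrite mul1n; apply: leq_trans mk _.
(* Gamma < 16 (s + 1) <= 32 s, so m < 3 Gamma^2 <= 3072 s^2 < 64^2 s^2; this is the case that
   determines the constant 64^2. *)
have : k.+1 <= 32 * s by lia.
by rewrite -mulnn; clear; nia.
Qed.

End SparseFamilies.

(** * Invariance under relabelling of the vertices *)

Section Relabel.
Local Open Scope nat_scope.
Local Open Scope set_scope.
Variables (n : nat) (f g : 'I_n -> 'I_n).
Hypotheses (fK : cancel f g) (gK : cancel g f).
Implicit Types (E : {set {set 'I_n}}).

Definition relabel E : {set {set 'I_n}} := [set f @: (e : {set 'I_n}) | e in E].

Lemma adj_relabel E x y : adj (relabel E) x y = adj E (g x) (g y).
Proof.
rewrite /adj -[in LHS](gK x) -[in LHS](gK y) -!imset_set1 -imsetU.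
by rewrite mem_imset //; apply: imset_inj; apply: can_inj fK.
Qed.

Lemma card_relabel E : #|relabel E| = #|E|.
Proof. by rewrite card_imset //; apply: imset_inj; apply: can_inj fK. Qed.

Lemma simple_relabel E : simple E -> simple (relabel E).
Proof.
by move=> sE _ /imsetP[e /sE <- ->]; rewrite card_imset //; apply: can_inj fK.
Qed.

Lemma cover_relabel E x : (x \in cover (relabel E)) = (g x \in cover E).
Proof.
apply/bigcupP/bigcupP => [[_ /imsetP[e eE ->] /imsetP[y ye ->]]|[e eE xe]].
  by exists e; rewrite // fK.
by exists (f @: e); [apply: imset_f|apply/imsetP; exists (g x)].
Qed.

Lemma triangle_free_relabel E : triangle_free E -> triangle_free (relabel E).
Proof.
move=> tE [u [v [w [[uv vw uw] []]]]]; rewrite !adj_relabel => Euv Evw Euw.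
by apply: tE; exists (g u), (g v), (g w); rewrite !(can_eq gK).
Qed.

Lemma forest_relabel E : forest E -> forest (relabel E).
Proof.
move=> fE c /andP[cE uE]; rewrite -(size_map g); apply: fE.
apply/andP; split; last by rewrite map_inj_uniq //; apply: can_inj gK.
case: c cE {uE} => //= x p; rewrite -map_rcons path_map.
by apply: sub_path => a b; rewrite /= adj_relabel.
Qed.

Lemma arboric_relabel k E : arboric k E -> arboric k (relabel E).
Proof.
move=> [F [fF cF]]; exists (fun i => relabel (F i)); split=> [i|].
  exact: forest_relabel.
by move=> _ /imsetP[e /cF[i ei] ->]; exists i; apply: imset_f.
Qed.

End Relabel.

Lemma relabelK (n : nat) (f g : 'I_n -> 'I_n) : cancel f g ->
  cancel (relabel f) (relabel g).
Proof.
move=> fK E; apply/setP => e; apply/imsetP/idP => [[_ /imsetP[e' e'E ->] ->]|eE].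
  rewrite -imset_comp (eq_imset _ (g := id)) ?imset_id //.
exists (f @: e)%SET; first exact: imset_f.
by rewrite -imset_comp (eq_imset _ (g := id)) ?imset_id.
Qed.

(** * Runs that see only isolated vertices *)

Section NullRun.
Local Open Scope nat_scope.
Local Open Scope set_scope.
Variable n : nat.

(** A pair query is answered negatively as soon as one of its vertices is isolated, so recording the
    first one suffices. *)
Definition query_vertex (q : query n) : 'I_n :=
  match q with Degree v => v | Neighbor v _ => v | VertexPair u _ => u end.

Definition null_answer (q : query n) : answer q :=
  match q with Degree _ => 0 | Neighbor _ _ => None | VertexPair _ _ => false end.

Lemma respond_isolated (X : graph_input n) q :
  query_vertex q \notin cover (edges X) -> respond X q = null_answer q.
Proof.
have nadj v u : v \notin cover (edges X) -> adj X v u = false.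
  by move=> vX; apply/negP => vu; case/negP: vX; apply: (mem_cover vu); rewrite set21.
case: q => [v|v i|u v] /= vX; last exact: nadj.
  by apply/eqP; rewrite cards_eq0; apply/eqP/setP => u; rewrite !inE nadj.
have -> : nbrs X v = [::]; last by case: i.
by case: (nbrs X v) (mem_nbrs X v) => // u s /(_ u); rewrite mem_head nadj.
Qed.

(* The run in which all vertices look isolated, cut after [q] queries. *)
Fixpoint null_output q (t : dtree n) : bool :=
  match q, t with
  | _, Output b => b
  | 0, Ask _ _ => true
  | q'.+1, Ask a k => null_output q' (k (null_answer a))
  end.

Fixpoint null_vertices q (t : dtree n) : seq 'I_n :=
  match q, t with
  | q'.+1, Ask a k => query_vertex a :: null_vertices q' (k (null_answer a))
  | _, _ => [::]
  end.

Lemma size_null_vertices q t : size (null_vertices q t) <= q.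
Proof. by elim: q t => [|q IH] [b|a k] //=; rewrite ltnS. Qed.

(** While no queried vertex lies in the support, the real answers are the null answers, so the run
    follows the null run; it ends within [q] queries, before the cut-off value [true] is reached. *)
Lemma output_null (X : graph_input n) q t : num_queries t X <= q ->
  {in null_vertices q t, forall v, v \notin cover (edges X)} ->
  output t X = null_output q t.
Proof.
elim: q t => [|q IH] [b|a k] //=; rewrite ltnS => le nv.
have aX : query_vertex a \notin cover (edges X) by apply: nv; rewrite mem_head.
rewrite respond_isolated // in le *; apply: IH => // v vk.
by apply: nv; rewrite inE vk orbT.
Qed.

Lemma simple_edges (G : sgraph n) : simple (edges G).
Proof. by move=> e; apply: edges_pair. Qed.

Definition canonical_input (G : sgraph n) : graph_input n.
Proof.
apply: (@GraphInput n G (fun v => enum (nbrs_in (edges G) v))) => [v|v u].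
  exact: enum_uniq.
by rewrite mem_enum inE.
Defined.

End NullRun.

(** * Cyclic shifts of the labels *)

Section Shift.
Local Open Scope nat_scope.
Local Open Scope set_scope.
Variable N : nat.
Local Notation n := N.+1.
Implicit Types (E : {set {set 'I_n}}) (G : sgraph n).

Lemma shiftK (r : 'I_n) : cancel (+%R^~ r : 'I_n -> 'I_n) (fun x => x - r)%R.
Proof. by move=> x; rewrite addrK. Qed.

Lemma shiftKV (r : 'I_n) : cancel (fun x : 'I_n => x - r)%R (+%R^~ r).
Proof. by move=> x; rewrite subrK. Qed.

Definition shift_graph (r : 'I_n) G : sgraph n :=
  @SGraph n (relabel (+%R^~ r) (edges G))
    (simple_relabel (shiftK r) (@simple_edges n G)).

Lemma in_family_shift r G m k : in_family m k.+1 G -> in_family m k.+1 (shift_graph r G).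
Proof.
move=> [cG /has_arboricity_arboric[aG nG]]; split=> /=.
  by rewrite (card_relabel (shiftK r)).
apply/has_arboricity_arboric; split; first exact: arboric_relabel (shiftK r) (shiftKV r) _ _ aG.
move=> /(arboric_relabel (shiftKV r) (shiftK r)); rewrite relabelK //.
exact: shiftK.
Qed.

Lemma far_shift (R : realType) (eps : R) r G :
  far_from_triangle_free eps G -> far_from_triangle_free eps (shift_graph r G).
Proof.
move=> fG F sF tF /=; rewrite (card_relabel (shiftK r)).
rewrite -(card_relabel (shiftKV r) F).
have e : edges G = relabel (fun x => x - r)%R (relabel (+%R^~ r) (edges G)).
  by rewrite relabelK //; apply: shiftK.
apply: fG; first by rewrite e; apply: imsetS.
have := triangle_free_relabel (shiftKV r) (shiftK r) tF; apply: triangle_free_sub.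
rewrite {1}e /=; apply/subsetP => x /setDP[/imsetP[y yE ->] nx].
apply/imsetP; exists y => //; apply/setDP; split=> //.
by apply: contra nx => yF; apply: imset_f.
Qed.

(** For a fixed [v] the map r -> v - r is injective, so [v] lies in the support of at most [K]
    shifted graphs; this is summed over [s]. *)
Lemma card_shift_hits G K (s : seq 'I_n) : #|cover (edges G)| <= K ->
  #|[set r | has (fun v => v \in cover (edges (shift_graph r G))) s]| <= size s * K.
Proof.
move=> cK; elim: s => [|v s IH] /=.
  by rewrite (_ : [set _ | _] = set0) ?cards0 //; apply/setP => r; rewrite !inE.
apply: (@leq_trans #|[set r : 'I_n | (v - r)%R \in cover (edges G)] :|:
  [set r | has (fun v => v \in cover (edges (shift_graph r G))) s]|).
  apply/subset_leq_card/subsetP => r; rewrite !inE.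
  by rewrite (cover_relabel (shiftK r) (shiftKV r)).
rewrite mulSn; apply: leq_trans (leq_card_setU _ _) (leq_add _ IH).
apply: leq_trans cK; rewrite -(card_imset [set r | _] (f := fun r : 'I_n => (v - r)%R)).
  by apply/subset_leq_card/subsetP => x /imsetP[r]; rewrite inE => + ->.
by move=> a b /addrI/oppr_inj.
Qed.

End Shift.

(** * The averaging argument *)

Section Hiding.
Variable R : realType.

(** The sum is the expected number of events that occur, and this number is at most [N] at every
    outcome. *)
Lemma sum_probability_le d (T : measurableType d) (P : probability T R)
    (I : finType) (A : I -> set T) (N : nat) :
  (forall i, measurable (A i)) ->
  (forall w, #|[set i | `[< A i w >]]%SET| <= N)%N ->
  (\sum_i P (A i) <= N%:R%:E)%E.
Proof.
move=> mA cA.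
have -> : (\sum_i P (A i) = \int[P]_w (\sum_i (\1_(A i) w)%:E))%E.
  rewrite ge0_integral_sum //.
  - by apply: eq_bigr => i _; rewrite integral_indic ?classical_sets.setIT.
  - move=> i; apply/measurable_realfun.measurable_EFinP.
    exact: measurable_realfun.measurable_indic.
have -> : (N%:R%:E = \int[P]_w (cst N%:R%:E w))%E.
  by rewrite integral_cst // [X in (_ * X)%E]probability_setT mule1.
apply: ge0_le_integral => //.
- by move=> w _; apply: sume_ge0 => i _; rewrite lee_fin.
- apply: emeasurable_sum => i; apply/measurable_realfun.measurable_EFinP.
  exact: measurable_realfun.measurable_indic.
- move=> w _; rewrite sumEFin lee_fin.
  apply: (@le_trans _ _ #|[set i | `[< A i w >]]%SET|%:R); last by rewrite ler_nat.
  rewrite -sum1_card natr_sum [leRHS]big_mkcond /=; apply: ler_sum => i _.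
  rewrite indicE in_set; case: asboolP => Aw.
    by rewrite (classical_sets.mem_set Aw).
  by rewrite (classical_sets.memNset Aw).
Qed.

(* Average over the [n] cyclic shifts of the labels: a query hits the support of a
   shifted graph for at most [K] of them. *)
Lemma hiding_bound (eps : R) (n m k q K : nat) (A : rand_alg R n) (G0 G1 : sgraph n) :
  triangle_freeness_tester eps m k.+1 A -> makes_at_most m k.+1 A q ->
  in_family m k.+1 G0 -> triangle_free G0 -> (#|cover (edges G0)| <= K)%N ->
  in_family m k.+1 G1 -> far_from_triangle_free eps G1 -> (#|cover (edges G1)| <= K)%N ->
  (n <= 3 * (q * K))%N.
Proof.
case: n A G0 G1 => [//|N] A G0 G1 tA qA fam0 tf0 c0 fam1 far1 c1.
(* The index (r, b) stands for the shift by [r] of the graph whose correct answer is [b]. *)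
pose X (i : 'I_N.+1 * bool) := canonical_input (shift_graph i.1 (if i.2 then G0 else G1)).
have famX i : in_family m k.+1 (X i).
  by case: i => r [] /=; apply: in_family_shift.
pose S i : set (coins A) := [set w | output (tree w) (X i) = i.2]%classic.
have mS i : measurable (S i) by apply: measurable_output.
have PS i : ((2 / 3)%:E <= law A (S i))%E.
  case: i => r []; have [] := tA _ (famX (r, true)); have [] := tA _ (famX (r, false)).
    move=> _ _ h _; apply: h; exact: triangle_free_relabel (shiftK r) (shiftKV r) _ tf0.
  by move=> _ h _ _; apply: h; apply: far_shift.
(* For fixed coins the null run outputs some [b]. All n instances with correct answer [b] may be
   answered correctly; one with the other answer is so only if the null run hits its support, that
   is for at most q K shifts. *)
have count w : (#|[set i | `[< S i w >]]%SET| <= N.+1 + q * K)%N.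
  pose b := null_output q (tree w).
  pose hit G := [set r | has (fun v => v \in cover (edges (shift_graph r G)))
                          (null_vertices q (tree w))]%SET.
  have ch G : (#|cover (edges G)| <= K -> #|hit G| <= q * K)%N.
    move=> cG; apply: leq_trans (card_shift_hits _ cG) _.
    by rewrite leq_mul2r size_null_vertices orbT.
  apply: (@leq_trans #|[set (r, b) | r in [set: 'I_N.+1]] :|:
      [set (r, ~~ b) | r in hit (if ~~ b then G0 else G1)]|%SET).
    apply/subset_leq_card/subsetP => -[r b']; rewrite inE => /asboolP Srb.
    rewrite inE; have [->|bb] := eqVneq b' b.
      by apply/orP; left; apply/imsetP; exists r.
    have eb : b' = ~~ b by case: b' b bb {Srb} => [] [].
    apply/orP; right; apply/imsetP; exists r; last by rewrite eb.
    rewrite inE; apply: contraT => /hasPn nohit.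
    have := @output_null _ (X (r, b')) q (tree w) (qA _ (famX _) w).
    rewrite Srb /= => e; case/eqP: bb; apply: e => v /nohit.
    by rewrite eb.
  apply: leq_trans (leq_card_setU _ _) (leq_add _ _).
    by apply: leq_trans (leq_imset_card _ _) _; rewrite cardsT card_ord.
  apply: leq_trans (leq_imset_card _ _) _; apply: ch; by case: (~~ b).
(* Over all 2n instances this gives (2 / 3) 2n <= n + q K. *)
have le : (\sum_(i : 'I_N.+1 * bool) (2 / 3 : R)%:E <= (N.+1 + q * K)%:R%:E)%E.
  apply: (le_trans _ (@sum_probability_le _ _ (law A) _ _ _ mS count)).
  by apply: lee_sum => i _; apply: PS.
move: le; rewrite sumEFin lee_fin sumr_const card_prod card_ord card_bool.
rewrite -[(2 / 3) *+ _]mulr_natr mulrAC ler_pdivrMr // -!natrM ler_nat; clear; lia.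
Qed.

End Hiding.

(** * The two hard graphs and the lower bound *)

Lemma far_of_triangle_far (R : realType) (eps : R) n (G : sgraph n) p :
  eps <= 64^-1 * 64^-1 -> (#|edges G| < 64 * (64 * p))%N -> triangle_far p (edges G) ->
  far_from_triangle_free eps G.
Proof.
move=> le lt fG F _ /fG pF.
apply: (@lt_le_trans _ _ p%:R); last by rewrite ler_nat.
apply: (@le_lt_trans _ _ (64^-1 * 64^-1 * #|edges G|%:R)).
  exact: ler_wpM2r.
have pos : 0 < (64 : R) by rewrite ltr0n.
by rewrite -mulrA mulrC ltr_pdivrMr // mulrC ltr_pdivrMr // -mulrA -!natrM ltr_nat mulnC -mulnA.
Qed.

Lemma in_family_bounded n k m (G : sgraph n) U :
  bounded_graph k.+1 (edges G) U -> ~ arboric k (edges G) -> #|edges G| = m ->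
  in_family m k.+1 G.
Proof. by move=> [_ aG _] nG cG; split=> //; apply/has_arboricity_arboric. Qed.

Lemma hard_pair (R : realType) (eps : R) n m k :
  0 < eps -> eps <= 64^-1 * 64^-1 -> (32 * m <= k.+1 * n)%N ->
  nontrivial_family eps n m k.+1 ->
  exists (G0 G1 : sgraph n) (K : nat),
    [/\ in_family m k.+1 G0, triangle_free G0 & (#|cover (edges G0)| <= K)%N] /\
    [/\ in_family m k.+1 G1, far_from_triangle_free eps G1,
        (#|cover (edges G1)| <= K)%N & (K * k.+1 <= 32 * m)%N].
Proof.
move=> eps0 leps room [[G0 fam0 tf0] [G1 fam1 far1]].
have [c0 /has_arboricity_arboric[_ nG0]] := fam0.
have [c1 /has_arboricity_arboric[aG1 _]] := fam1.
have s0 := @simple_edges n G0.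
(* A graph of arboricity 1 has no triangle, so it is not far: removing the empty set is enough. *)
have k0 : (0 < k)%N.
  case: k aG1 {room fam0 fam1 nG0} => // /arboric1_triangle_free tG1.
  have := far1 finset.set0 (sub0set _); rewrite finset.setD0 => /(_ tG1).
  by rewrite cards0 ltNge mulr_ge0 // ltW.
(* In the small case the given graphs serve: m edges have at most 2m endpoints, and 2 m Gamma <= 30
   m. *)
have [small|large] := boolP ((k.+1 < 16) && (m < 3 * k.+1 ^ 2))%N.
  exists G0, G1, m.*2; split; split=> //.
  - by rewrite -c0 card_cover_simple.
  - by rewrite -c1; apply: card_cover_simple; apply: simple_edges.
  - by move: small => /andP[k16 _]; rewrite -muln2; clear -k16; nia.
have room5 : (5 * m <= k.+1 * n)%N by apply: leq_trans room; rewrite leq_mul2r orbT.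
have [E0 [U0 [g0 n0 cE0 cU0 t0]]] := sparse_triangle_free s0 c0 tf0 nG0 room5.
have [E1 [U1 [p [g1 n1 cE1 [cU1 mp] f1]]]] :
    exists E (U : {set 'I_n}) p, [/\ bounded_graph k.+1 E U, ~ arboric k E, #|E| = m,
      (#|U| * k.+1 <= 5 * m)%N /\ (m < 64 * (64 * p))%N & triangle_far p E].
  have [mk|mk] := leqP (3 * k.+1 ^ 2)%N m; first exact: sparse_far_large.
  apply: (sparse_far_small s0 c0 tf0 nG0 _ mk room5).
  by move: large; rewrite mk andbT -leqNgt.
have [sE0 _ sU0] := g0; have [sE1 _ sU1] := g1.
exists (SGraph sE0), (SGraph sE1), (maxn #|U0| #|U1|); split; split.
- exact: (@in_family_bounded _ _ _ (SGraph sE0)) g0 n0 cE0.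
- exact: t0.
- by rewrite leq_max subset_leq_card.
- exact: (@in_family_bounded _ _ _ (SGraph sE1)) g1 n1 cE1.
- by apply: (@far_of_triangle_far _ _ _ (SGraph sE1) p leps _ f1); rewrite /= cE1.
- by rewrite leq_max orbC subset_leq_card.
- have le32 : (5 * m <= 32 * m)%N by rewrite leq_mul2r orbT.
  by rewrite maxnMl geq_max (leq_trans cU0 le32) (leq_trans cU1 le32).
Qed.

Theorem theorem1 (R : realType) :
  exists eps0 c : R, 0 < eps0 /\ 0 < c /\
    forall (eps : R) (n m Gamma : nat),
      0 < eps -> eps <= eps0 ->
      (Gamma <= n - 1)%N -> (1 <= m)%N -> feasible n m Gamma ->
      nontrivial_family eps n m Gamma ->
      forall (A : rand_alg R n) (q : nat),
        triangle_freeness_tester eps m Gamma A ->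
        makes_at_most m Gamma A q ->
        c * (Gamma%:R * n%:R / m%:R) <= q%:R.
Proof.
(* The bound on eps comes from m < 64^2 p, and 96 = 3 * 32 combines n <= 3 q K with K Gamma <= 32
   m. *)
exists (64^-1 * 64^-1), (1 / 96); split; first by rewrite mulr_gt0 // invr_gt0.
split; first by rewrite divr_gt0.
move=> eps n m Gamma eps_gt0 eps_le _ m_gt0 _ nontriv A q testA qA.
suff le : (Gamma * n <= 96 * (q * m))%N.
  rewrite mul1r mulrC ler_pdivrMr // ler_pdivrMr ?ltr0n //.
  by rewrite -!natrM ler_nat; apply: leq_trans le _; clear; lia.
case: Gamma nontriv testA qA => [//|k] nontriv testA qA.
have [room|noroom] := leqP (32 * m)%N (k.+1 * n)%N.
  have [G0 [G1 [K [[fam0 tf0 c0] [fam1 far1 c1 cK]]]]] :=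
    hard_pair eps_gt0 eps_le room nontriv.
  have := hiding_bound testA qA fam0 tf0 c0 fam1 far1 c1.
  by move: cK; clear; nia.
(* Here Gamma n < 32 m, so q >= 1 is enough; the hiding bound with the trivial K = n gives n <= 3 q
   n, which excludes q = 0 unless n = 0. *)
have [[G0 fam0 tf0] [G1 fam1 far1]] := nontriv.
have leK (G : sgraph n) : (#|cover (edges G)| <= n)%N.
  by apply: leq_trans (max_card _) _; rewrite card_ord.
have := hiding_bound testA qA fam0 tf0 (leK G0) fam1 far1 (leK G1).
by move: noroom; clear; case: q => [|q]; [case: n => //; lia|nia].
Qed.
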